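(* Let $G$ be an infinite (i.e. non-discrete) compact abelian group. Fix $p>2$. Let $\delta>0$ and let $x=\lambda\mathbf 1+f\in L^p(G)_1$ (with $\lambda\in\mathbb C$, $f\in L^p(G)$) satisfy $$\|x\|_{L^p(G)_1}\le 1\qquad\text{and}\qquad \inf_{\gamma\in\widehat G}|\widehat x(\gamma)|\ge\delta.$$ Let $n$ be the smallest odd integer with $n\ge p-1$, and define $c_n(\delta):=1-(1-\delta^2)^n$. Then $x$ is invertible in $L^p(G)_1$ and $$\|x^{-1}\|_{L^p(G)_1}\le \delta^{-2n}+\frac{\delta^{-4n}}{c_n(\delta)}.$$
   Context: $G$ is a compact abelian (Hausdorff) group with Haar measure normalized by $m(G)=1$; $\widehat G$ is its discrete Pontryagin dual; $\widehat f(\gamma)=\int_G f(t)\overline{\gamma(t)}\,dt$ for $f\in L^1(G)$, $\gamma\in\widehat G$. For $1\le p<\infty$, $L^p(G)$ is a commutative Banach algebra under convolution, and $L^p(G)_1=\mathbb C\mathbf 1\oplus L^p(G)$ denotes its unitization, with product $(\lambda\mathbf 1+f)(\mu\mathbf 1+g)=\lambda\mu\mathbf 1+(\lambda g+\mu f+f*g)$ and norm $\|\lambda\mathbf 1+f\|_{L^p(G)_1}=|\lambda|+\|f\|_{L^p(G)}$. For $x=\lambda\mathbf 1+f$ and $\gamma\in\widehat G$ one puts $\widehat x(\gamma)=\lambda+\widehat f(\gamma)$. *)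

(* Defs.v *)
From HB Require Import structures.
From mathcomp Require Import all_boot all_order all_algebra.
From mathcomp Require Import all_classical all_reals all_analysis.
From mathcomp Require Import complex.

Set Implicit Arguments.
Unset Strict Implicit.
Unset Printing Implicit Defensive.

Import Order.TTheory GRing.Theory Num.Theory.
Import numFieldNormedType.Exports.

Local Open Scope classical_set_scope.
Local Open Scope ring_scope.
Local Open Scope complex_scope.

(* Groups are written additively. Measurable types must be pointed, which
   [topologicalZmodType] does not provide: 0 is the base point. *)
Definition pointed_group (G : topologicalZmodType) : Type := G.
HB.instance Definition _ (G : topologicalZmodType) :=
  Choice.copy (pointed_group G) G.
HB.instance Definition _ (G : topologicalZmodType) :=
  isPointed.Build (pointed_group G) (0 : G).

(* An alias of [G] carrying its Borel sigma-algebra. *)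
Definition borel (G : topologicalZmodType) :=
  g_sigma_algebraType (@open G : set (set (pointed_group G))).

(* Haar probability measure: a translation-invariant regular Borel probability.
   Regularity is not automatic when [G] is not metrizable. *)
Definition is_haar (R : realType) (G : topologicalZmodType)
    (m : probability (borel G) R) : Prop :=
  [/\ forall (a : G) (A : set G), measurable (A : set (borel G)) ->
        m [set a + t | t in A] = m A,
      forall A : set G, measurable (A : set (borel G)) ->
        m A = ereal_inf [set m U | U in [set U : set G | open U /\ A `<=` U]]
    & forall U : set G, open U ->
        m U = ereal_sup
          [set m K | K in [set K : set G | compact K /\ K `<=` U]] ].

(* The underlying set of the Pontryagin dual: continuous homomorphisms from
   [G] to the unit circle. *)
Definition chargroup (R : realType) (G : topologicalZmodType) : set (G -> R[i]) :=
  [set chi | [/\ continuous (chi : G -> R[i]^o),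
                 forall s t, chi (s + t) = chi s * chi t
               & forall t, Normc.normc (chi t) = 1] ].

Section GroupAlgebra.
Context (R : realType) (G : topologicalZmodType).
Variable m : probability (borel G) R.

Definition cintegral (f : G -> R[i]) : R[i] :=
  Rintegral m setT (fun t : borel G => complex.Re (f t)) +i*
  Rintegral m setT (fun t : borel G => complex.Im (f t)).

Definition cmeasurable (f : G -> R[i]) : Prop :=
  measurable_fun setT (fun t : borel G => complex.Re (f t)) /\
  measurable_fun setT (fun t : borel G => complex.Im (f t)).

Definition cLnorm (p : R) (f : G -> R[i]) : \bar R :=
  Lnorm m p%:E (fun t : borel G => (Normc.normc (f t))%:E).

(* Elements of L^p are represented by functions; the identification of
   almost everywhere equal functions is made in [ueq] below. *)
Definition Lp (p : R) : set (G -> R[i]) :=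
  [set f | cmeasurable f /\ (cLnorm p f < +oo)%E].

Definition fourier (f : G -> R[i]) (chi : G -> R[i]) : R[i] :=
  cintegral (fun t => f t * (chi t)^*).

(* Defined at every point for f, g in L^2, hence in L^p for p >= 2, since the
   Haar measure is finite. *)
Definition convolution (f g : G -> R[i]) : G -> R[i] :=
  fun t => cintegral (fun s => f (t - s) * g s).

(* The pair [(lambda, f)] stands for lambda 1 + f. *)
Definition Lp1 (p : R) : set (R[i] * (G -> R[i])) := [set x | Lp p x.2].

Definition unorm (p : R) (x : R[i] * (G -> R[i])) : \bar R :=
  ((Normc.normc x.1)%:E + cLnorm p x.2)%E.

Definition umul (x y : R[i] * (G -> R[i])) : R[i] * (G -> R[i]) :=
  (x.1 * y.1, fun t => x.1 * y.2 t + y.1 * x.2 t + convolution x.2 y.2 t).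

Definition uone : R[i] * (G -> R[i]) := (1, fun=> 0).

Definition ueq (x y : R[i] * (G -> R[i])) : Prop :=
  x.1 = y.1 /\ {ae m, forall t : borel G, x.2 t = y.2 t}.

Definition ufourier (x : R[i] * (G -> R[i])) (chi : G -> R[i]) : R[i] :=
  x.1 + fourier x.2 chi.

Definition is_uinverse (p : R) (x y : R[i] * (G -> R[i])) : Prop :=
  [/\ Lp1 p y, ueq (umul x y) uone & ueq (umul y x) uone].

End GroupAlgebra.

Definition cn (R : realType) (n : nat) (delta : R) : R :=
  1 - (1 - delta ^+ 2) ^+ n.

(* Main.v *)
Require Import Defs.
From HB Require Import structures.
From mathcomp Require Import all_boot all_order all_algebra.
From mathcomp Require Import all_classical all_reals all_analysis.
From mathcomp Require Import measurable_realfun.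
From mathcomp Require Import complex zify ring lra.
Import Order.TTheory GRing.Theory Num.Theory.
Import numFieldNormedType.Exports.
Local Open Scope classical_set_scope.
Local Open Scope ring_scope.
Local Open Scope complex_scope.

(* Put mu = |lambda|^2 and let x^* be the adjoint of x, so that x x^* = mu + h with
   ||h||_p <= 1 - mu. As n is odd, mu + h divides z = mu^n + h^n, the cofactor
   S = sum_(j < n) mu^(n-1-j) (-h)^j has norm at most 1, and the Fourier transform
   of z is at least mu^n c_n. The transform of z^-1 - mu^-n is dominated by
   |hat h|^n / (mu^(2n) c_n), which is summable by Bessel's inequality because
   n >= 2, so z^-1 = mu^-n + g with |g| <= mu^(-2n) / c_n everywhere. Then
   x^-1 = x^* S z^-1. Norms are submultiplicative since
   ||f * g||_p <= ||f * g||_oo <= ||f||_2 ||g||_2 <= ||f||_p ||g||_p, and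
   |lambda| >= delta because the coefficients of f accumulate at 0, the dual of G
   being infinite.

   That characters separate L^2 is proved through convolution idempotents. If k is
   a continuous hermitian kernel, its even convolution powers, normalised by the
   spectral radius, converge uniformly to an idempotent e <> 0 on which k * k acts
   as a positive scalar. Below e there is a minimal idempotent, and minimality
   forces every translate of it to be proportional to it, that is, it is a multiple
   of a character chi, with hat k chi <> 0. *)

Set Implicit Arguments.
Unset Strict Implicit.
Unset Printing Implicit Defensive.

Local Notation nc := Normc.normc.
(* [_^*] would otherwise denote either [conjc] or [Num.conj], depending on the
   scope in which it is parsed. *)
Local Notation "z ^*" := (Num.conj z) : complex_scope.

(** * Complex numbers *)

Section ComplexModulus.
Context {R : rcfType}.
Implicit Types z w : R[i].

(** The inverse of mu + h minus 1 / mu has Fourier coefficients of the size of hat h only: they are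
    square summable, which gives no bounded function and hence no L^p bound. Multiplying by the
    cofactor S replaces hat h by its n-th power at no cost in norm, and p > 2 makes n at least 3.
    Passing to x x^* makes the transform real, so that an odd power can be kept away from 0. The
    factors of x^-1 = x^* S z^-1 have norms at most 1, 1 and mu^-n + mu^(-2n) / c_n; since mu >=
    delta^2, the product is below the stated bound.

    G may fail to be metrizable, and then Borel sets of the product of G with itself may escape the
    product sigma-algebra. Fubini's theorem is therefore replaced by one identity for continuous
    kernels. It yields inversion invariance of integrals of continuous functions and associativity
    of convolution with a continuous middle factor; regularity carries these over to Borel sets and
    to L^2.

    Proportionality to a minimal idempotent e comes from power iteration itself: applied to a
    hermitian function fixed by e, it can only return e. *)

Lemma ncE z : nc z = Num.sqrt (complex.Re z ^+ 2 + complex.Im z ^+ 2).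
Proof. by case: z. Qed.

Lemma nc_ge0 z : 0 <= nc z.
Proof. by rewrite ncE sqrtr_ge0. Qed.

Lemma sqr_nc z : nc z ^+ 2 = complex.Re z ^+ 2 + complex.Im z ^+ 2.
Proof. by rewrite ncE sqr_sqrtr// addr_ge0 ?sqr_ge0. Qed.

Lemma conjcE z : z^* = complex.Re z -i* complex.Im z.
Proof. by rewrite -[LHS]/(conjc z); case: z. Qed.

Lemma nc_conj z : nc z^* = nc z.
Proof. by rewrite conjcE !ncE /= sqrrN. Qed.

Lemma mul_conjc z : z * z^* = (nc z ^+ 2)%:C.
Proof.
by rewrite sqr_nc conjcE; case: z => a b; rewrite /=; simpc; congr (_ +i* _); ring.
Qed.

Lemma nc_real (x : R) : nc x%:C = `|x|.
Proof. by rewrite ncE /= expr0n addr0 sqrtr_sqr. Qed.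

Lemma nc_realB (x y : R) : nc (x%:C - y%:C) = `|x - y|.
Proof. by rewrite ncE /= oppr0 addr0 expr0n addr0 sqrtr_sqr. Qed.

Lemma nc_eq0 z : (nc z == 0) = (z == 0).
Proof.
by apply/eqP/eqP => [/Normc.eq0_normc//|->]; rewrite Normc.normc0.
Qed.

Lemma nc_gt0 z : (0 < nc z) = (z != 0).
Proof. by rewrite lt_def nc_eq0 nc_ge0 andbT. Qed.

Lemma le_ncD z w : nc (z + w) <= nc z + nc w.
Proof. exact: le_normcD. Qed.

Lemma nc_distC z w : nc (z - w) = nc (w - z).
Proof. by rewrite -normcN opprB. Qed.

Lemma le_ncB z w : nc z - nc w <= nc (z - w).
Proof. by rewrite lerBlDr -{1}(subrK w z) le_ncD. Qed.

Lemma le_nc_sum (I : Type) (s : seq I) (F : I -> R[i]) :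
  nc (\sum_(i <- s) F i) <= \sum_(i <- s) nc (F i).
Proof.
elim/big_ind2: _ => // [|x a y b xa yb]; first by rewrite Normc.normc0.
by rewrite (le_trans (le_ncD _ _))// lerD.
Qed.

Lemma nc_Re z : `|complex.Re z| <= nc z.
Proof.
rewrite -(@ler_pXn2r _ 2)// ?nnegrE ?nc_ge0// real_normK ?num_real// sqr_nc.
by rewrite lerDl sqr_ge0.
Qed.

Lemma nc_Im z : `|complex.Im z| <= nc z.
Proof.
rewrite -(@ler_pXn2r _ 2)// ?nnegrE ?nc_ge0// real_normK ?num_real// sqr_nc.
by rewrite lerDr sqr_ge0.
Qed.

Lemma nc_le_ReIm z : nc z <= `|complex.Re z| + `|complex.Im z|.
Proof.
rewrite -(@ler_pXn2r _ 2)// ?nnegrE ?nc_ge0 ?addr_ge0// sqr_nc sqrrD.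
rewrite !real_normK ?num_real// lerD2r lerDl mulrn_wge0// mulr_ge0//.
Qed.

Lemma ReM z w :
  complex.Re (z * w) =
  complex.Re z * complex.Re w - complex.Im z * complex.Im w.
Proof. by case: z; case: w. Qed.

Lemma ImM z w :
  complex.Im (z * w) =
  complex.Re z * complex.Im w + complex.Im z * complex.Re w.
Proof. by case: z; case: w. Qed.

Lemma ReD z w : complex.Re (z + w) = complex.Re z + complex.Re w.
Proof. by case: z; case: w. Qed.

Lemma ImD z w : complex.Im (z + w) = complex.Im z + complex.Im w.
Proof. by case: z; case: w. Qed.

Lemma Re_conj z : complex.Re z^* = complex.Re z.
Proof. by rewrite conjcE. Qed.

Lemma Im_conj z : complex.Im z^* = - complex.Im z.
Proof. by rewrite conjcE. Qed.

Lemma complex_eq z w :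
  complex.Re z = complex.Re w -> complex.Im z = complex.Im w -> z = w.
Proof. by case: z; case: w => a b c d /= -> ->. Qed.

Lemma sqr_ncB z w : nc (z - w) ^+ 2 =
  nc z ^+ 2 - 2 * complex.Re (z * w^*) + nc w ^+ 2.
Proof. by rewrite conjcE; case: z; case: w => a b c d; rewrite !sqr_nc /=; ring. Qed.

Lemma sqr_ncD_le z w : nc (z + w) ^+ 2 <= 2 * nc z ^+ 2 + 2 * nc w ^+ 2.
Proof.
have := sqr_ge0 (nc (z - w)); case: z; case: w => a b c d; rewrite !sqr_nc /=.
lra.
Qed.

Lemma nc_mul_le z w : 2 * nc (z * w) <= nc z ^+ 2 + nc w ^+ 2.
Proof.
rewrite Normc.normcM; have := sqr_ge0 (nc z - nc w); rewrite sqrrB; lra.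
Qed.

Lemma conjcR (x : R) : (x%:C)^* = x%:C.
Proof. by rewrite conjcE; apply: complex_eq; rewrite /= ?oppr0. Qed.

Lemma conjcM z w : (z * w)^* = z^* * w^*.
Proof. exact: rmorphM. Qed.

Lemma conjcD z w : (z + w)^* = z^* + w^*.
Proof. exact: rmorphD. Qed.

Lemma conjcB z w : (z - w)^* = z^* - w^*.
Proof. exact: rmorphB. Qed.

End ComplexModulus.

(** * Integration of complex functions *)

Section ComplexIntegral.
Context {R : realType} {G : topologicalZmodType} (m : probability (borel G) R).
Implicit Types f g : G -> R[i].

Local Notation "'E[ h ]" := (Rintegral m setT (h : borel G -> R))
  (at level 0, h at level 99).
Local Notation integ h := (m.-integrable setT (EFin \o (h : borel G -> R))).

Definition cintegrable f :=
  integ (fun t => complex.Re (f t)) /\ integ (fun t => complex.Im (f t)).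

Definition L2 f := cmeasurable f /\ integ (fun t => nc (f t) ^+ 2).

(** The square of the L^2 norm: with it Cauchy-Schwarz, Bessel and the expansion of a difference are
    polynomial statements. *)
Definition N2 f := 'E[fun t => nc (f t) ^+ 2].

Lemma cmeasurable_nc f : cmeasurable f ->
  measurable_fun setT (fun t : borel G => nc (f t)).
Proof.
move=> [mr mi]; under eq_fun do rewrite ncE.
apply: (@measurableT_comp _ _ _ _ _ _ (@Num.sqrt R)).
  by apply: continuous_measurable_fun; exact: sqrt_continuous.
by apply: measurable_funD; apply: measurable_funX.
Qed.

Lemma cmeasurableD f g : cmeasurable f -> cmeasurable g ->
  cmeasurable (fun t => f t + g t).
Proof.
move=> [fr fi] [gr gi]; split.
- by under eq_fun do rewrite ReD; exact: measurable_funD.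
- by under eq_fun do rewrite ImD; exact: measurable_funD.
Qed.

Lemma cmeasurableM f g : cmeasurable f -> cmeasurable g ->
  cmeasurable (fun t => f t * g t).
Proof.
move=> [fr fi] [gr gi]; split.
- under eq_fun do rewrite ReM.
  by apply: measurable_funB; apply: measurable_funM.
- under eq_fun do rewrite ImM.
  by apply: measurable_funD; apply: measurable_funM.
Qed.

Lemma cmeasurable_cst (c : R[i]) : cmeasurable (fun _ : G => c).
Proof. by split; apply: measurable_cst. Qed.

Lemma cmeasurableZ (c : R[i]) f : cmeasurable f ->
  cmeasurable (fun t => c * f t).
Proof. by apply: cmeasurableM; apply: cmeasurable_cst. Qed.

Lemma cmeasurable_conj f : cmeasurable f -> cmeasurable (fun t => (f t)^*).
Proof.
move=> [fr fi]; split.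
- by under eq_fun do rewrite Re_conj.
- by under eq_fun do rewrite Im_conj; exact: measurableT_comp.
Qed.

Lemma integ_le (h k : borel G -> R) : measurable_fun setT h ->
  (forall t, `|h t| <= k t) -> integ k -> integ h.
Proof.
move=> mh hk ik; apply: (le_integrable measurableT _ _ ik).
  exact/measurable_EFinP.
by move=> t _ /=; rewrite lee_fin (le_trans (hk t))// ler_norm.
Qed.

Lemma integD (h k : borel G -> R) : integ h -> integ k -> integ (fun t => h t + k t).
Proof. by move=> ih ik; have := integrableD measurableT ih ik. Qed.

Lemma integZ (c : R) (h : borel G -> R) : integ h -> integ (fun t => c * h t).
Proof. by move=> ih; have := integrableZl measurableT c ih. Qed.

Lemma integB (h k : borel G -> R) : integ h -> integ k -> integ (fun t => h t - k t).
Proof. by move=> ih ik; have := integrableB measurableT ih ik. Qed.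

Lemma integ_cst (c : R) : integ (cst c).
Proof. exact: finite_measure_integrable_cst. Qed.

Lemma integ_meas (h : borel G -> R) : integ h -> measurable_fun setT h.
Proof. by move=> /measurable_int /measurable_EFinP. Qed.

Lemma Rintegral_le (h k : borel G -> R) : integ h -> integ k ->
  (forall t, h t <= k t) -> 'E[h] <= 'E[k].
Proof. by move=> ih ik hk; apply: le_Rintegral. Qed.

Lemma Rintegral1 (c : R) : 'E[cst c] = c.
Proof.
rewrite Rintegral_cst// (_ : fine _ = 1) ?mulr1//.
exact: (congr1 fine (@probability_setT _ _ _ m)).
Qed.

Lemma N2_ge0 f : 0 <= N2 f.
Proof. by apply: Rintegral_ge0 => t _; rewrite sqr_ge0. Qed.

Lemma cintegrable_meas f : cintegrable f -> cmeasurable f.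
Proof. by move=> [/integ_meas ? /integ_meas ?]. Qed.

Lemma cintegrable_le f (h : borel G -> R) : cmeasurable f ->
  (forall t, nc (f t) <= h t) -> integ h -> cintegrable f.
Proof.
move=> [fr fi] fh ih; split; apply: (integ_le _ _ ih) => // t.
- exact: le_trans (nc_Re _) (fh t).
- exact: le_trans (nc_Im _) (fh t).
Qed.

Lemma integ_nc f : cintegrable f -> integ (fun t => nc (f t)).
Proof.
move=> If; have [Ir Ii] := If.
apply: (@integ_le _ (fun t => `|complex.Re (f t)| + `|complex.Im (f t)|)).
- by apply: cmeasurable_nc; exact: cintegrable_meas.
- by move=> t; rewrite ger0_norm ?nc_ge0// nc_le_ReIm.
- by apply: integD; [exact: integrable_norm Ir|exact: integrable_norm Ii].
Qed.

Lemma cintegrableD f g : cintegrable f -> cintegrable g ->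
  cintegrable (fun t => f t + g t).
Proof.
move=> If Ig; apply: (@cintegrable_le _ (fun t => nc (f t) + nc (g t))).
- by apply: cmeasurableD; exact: cintegrable_meas.
- by move=> t; exact: le_ncD.
- by apply: integD; exact: integ_nc.
Qed.

Lemma cintegrableZ (c : R[i]) f : cintegrable f ->
  cintegrable (fun t => c * f t).
Proof.
move=> If; apply: (@cintegrable_le _ (fun t => nc c * nc (f t))).
- exact/cmeasurableZ/cintegrable_meas.
- by move=> t; rewrite Normc.normcM.
- exact/integZ/integ_nc.
Qed.

Lemma cintegrable_conj f : cintegrable f -> cintegrable (fun t => (f t)^*).
Proof.
move=> If; apply: (@cintegrable_le _ (fun t => nc (f t))).
- exact/cmeasurable_conj/cintegrable_meas.
- by move=> t; rewrite nc_conj.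
- exact: integ_nc.
Qed.

Lemma cintegrable_bounded f (B : R) : cmeasurable f ->
  (forall t, nc (f t) <= B) -> cintegrable f.
Proof. by move=> mf fB; apply: (cintegrable_le mf fB); exact: integ_cst. Qed.

Lemma cintegralD f g : cintegrable f -> cintegrable g ->
  cintegral m (fun t => f t + g t) = cintegral m f + cintegral m g.
Proof.
move=> [fr fi] [gr gi]; rewrite /cintegral; apply: complex_eq => /=.
- rewrite -RintegralD//; congr Rintegral; apply/funext => t; exact: ReD.
- rewrite -RintegralD//; congr Rintegral; apply/funext => t; exact: ImD.
Qed.

Lemma cintegralZ (c : R[i]) f : cintegrable f ->
  cintegral m (fun t => c * f t) = c * cintegral m f.
Proof.
move=> [fr fi]; rewrite /cintegral; apply: complex_eq => /=.
- rewrite ReM /= -!RintegralZl// -RintegralB//; last 2 first.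
  + exact: integZ.
  + exact: integZ.
  by congr Rintegral; apply/funext => t; exact: ReM.
- rewrite ImM /= -!RintegralZl// -RintegralD//; last 2 first.
  + exact: integZ.
  + exact: integZ.
  by congr Rintegral; apply/funext => t; exact: ImM.
Qed.

Lemma cintegralB f g : cintegrable f -> cintegrable g ->
  cintegral m (fun t => f t - g t) = cintegral m f - cintegral m g.
Proof.
move=> If Ig.
transitivity (cintegral m (fun t => f t + -1 * g t)).
  by congr cintegral; apply/funext => t; rewrite mulN1r.
by rewrite cintegralD ?cintegralZ ?mulN1r//; exact: cintegrableZ.
Qed.

Lemma cintegral_conj f : cintegrable f ->
  cintegral m (fun t => (f t)^*) = (cintegral m f)^*.
Proof.
move=> [fr fi]; rewrite /cintegral; apply: complex_eq => /=.
- by congr Rintegral; apply/funext => t; exact: Re_conj.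
- rewrite -mulN1r -RintegralZl//; congr Rintegral; apply/funext => t.
  by rewrite mulN1r Im_conj.
Qed.

Lemma cintegral_real (h : borel G -> R) :
  cintegral m (fun t => (h t)%:C) = ('E[h])%:C.
Proof.
rewrite /cintegral; apply: complex_eq => //=.
by rewrite Rintegral1.
Qed.

Lemma le_nc_cintegral f : cintegrable f ->
  nc (cintegral m f) <= 'E[fun t => nc (f t)].
Proof.
move=> If; set z := cintegral m f.
have [z0|zN0] := eqVneq z 0.
  by rewrite z0 Normc.normc0; apply: Rintegral_ge0 => t _; exact: nc_ge0.
(* A unit factor [u] rotates the integral onto the positive real axis, where only real parts have to
   be compared. *)
pose u := (nc z)^-1%:C * z^*.
have nu : nc u = 1.
  rewrite Normc.normcM nc_real nc_conj ger0_norm ?invr_ge0 ?nc_ge0//.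
  by rewrite mulVf// nc_eq0.
have uz : u * z = (nc z)%:C.
  rewrite /u -mulrA (mulrC _ z) mul_conjc -rmorphM expr2 mulrA mulVf ?mul1r//.
  by rewrite nc_eq0.
have -> : nc z = complex.Re (cintegral m (fun t => u * f t)).
  by rewrite cintegralZ// -/z uz.
rewrite /cintegral /=.
have [Ir _] := cintegrableZ u If.
apply: Rintegral_le => //; first exact: integ_nc.
move=> t; rewrite (le_trans (ler_norm _))// (le_trans (nc_Re _))//.
by rewrite Normc.normcM nu mul1r.
Qed.

Lemma L2D f g : L2 f -> L2 g -> L2 (fun t => f t + g t).
Proof.
move=> [mf If] [mg Ig]; split; first exact: cmeasurableD.
apply: (@integ_le _ (fun t => 2 * nc (f t) ^+ 2 + 2 * nc (g t) ^+ 2)).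
- by apply: measurable_funX; apply: cmeasurable_nc; exact: cmeasurableD.
- by move=> t; rewrite ger0_norm ?sqr_ge0// sqr_ncD_le.
- by apply: integD; exact: integZ.
Qed.

Lemma L2Z (c : R[i]) f : L2 f -> L2 (fun t => c * f t).
Proof.
move=> [mf If]; split; first exact: cmeasurableZ.
under eq_fun do rewrite Normc.normcM exprMn.
exact: integZ.
Qed.

Lemma L2B f g : L2 f -> L2 g -> L2 (fun t => f t - g t).
Proof.
move=> Lf Lg; have := L2D Lf (L2Z (-1) Lg).
by under [X in L2 X -> _]eq_fun do rewrite mulN1r.
Qed.

Lemma L2_conj f : L2 f -> L2 (fun t => (f t)^*).
Proof.
move=> [mf If]; split; first exact: cmeasurable_conj.
by under eq_fun do rewrite nc_conj.
Qed.

Lemma L2_bounded f (B : R) : cmeasurable f ->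
  (forall t, nc (f t) <= B) -> L2 f.
Proof.
move=> mf fB; split => //.
apply: (@integ_le _ (cst (B ^+ 2))); last exact: integ_cst.
- by apply: measurable_funX; exact: cmeasurable_nc.
- move=> t; rewrite ger0_norm ?sqr_ge0// lerXn2r// ?nnegrE ?nc_ge0//.
  exact: le_trans (nc_ge0 _) (fB t).
Qed.

Lemma L2_cst (c : R[i]) : L2 (fun=> c).
Proof. by apply: (@L2_bounded _ (nc c)) => //; exact: cmeasurable_cst. Qed.

Lemma L2_mul f g : L2 f -> L2 g -> cintegrable (fun t => f t * g t).
Proof.
move=> [mf If] [mg Ig].
apply: (@cintegrable_le _ (fun t => nc (f t) ^+ 2 + nc (g t) ^+ 2)).
- exact: cmeasurableM.
- move=> t; apply: le_trans (nc_mul_le _ _).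
  by rewrite mulr_natl mulr2n lerDl nc_ge0.
- exact: integD.
Qed.

Lemma L2_cintegrable f : L2 f -> cintegrable f.
Proof.
move=> Lf; have := L2_mul Lf (L2_cst 1).
by under [X in cintegrable X -> _]eq_fun do rewrite mulr1.
Qed.

Lemma cauchy_schwarz f g : L2 f -> L2 g ->
  nc (cintegral m (fun t => f t * g t)) ^+ 2 <= N2 f * N2 g.
Proof.
move=> Lf Lg; have Ifg := L2_mul Lf Lg.
set P := 'E[fun t => nc (f t * g t)].
have P0 : 0 <= P by apply: Rintegral_ge0 => t _; exact: nc_ge0.
suff PN : P ^+ 2 <= N2 f * N2 g.
  by rewrite (le_trans _ PN)// lerXn2r// ?nnegrE ?nc_ge0// le_nc_cintegral.
have [[mf If] [mg Ig]] := (Lf, Lg).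
(* This integrates (s |f| - |g|)^2 >= 0. The optimal s is P / N2 f; if N2 f = 0, the value s = (N2 g
   + 1) / P refutes P <> 0. *)
have key s : 2 * s * P <= s ^+ 2 * N2 f + N2 g.
  rewrite /N2 /P -!RintegralZl//; last exact: integ_nc.
  rewrite -RintegralD//; last exact: integZ.
  apply: Rintegral_le; first exact/integZ/integ_nc.
  - by apply: integD => //; exact: integZ.
  - move=> t; rewrite Normc.normcM.
    have := sqr_ge0 (s * nc (f t) - nc (g t)); rewrite sqrrB exprMn; lra.
have := N2_ge0 f; rewrite le_eqVlt => /orP[/eqP f0|f0].
  rewrite -f0 mul0r; have [->|PN0] := eqVneq P 0; first by rewrite expr0n.
  have := key ((N2 g + 1) / P); rewrite -f0 mulr0 add0r -mulrA divfK//.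
  by have := N2_ge0 g; lra.
have := key (P / N2 f); rewrite exprMn exprVn.
have -> : 2 * (P / N2 f) * P = 2 * (P ^+ 2 / N2 f) by rewrite expr2; ring.
have -> : P ^+ 2 / N2 f ^+ 2 * N2 f = P ^+ 2 / N2 f.
  by rewrite expr2 invfM mulrA divfK// gt_eqF.
move=> h; rewrite mulrC -ler_pdivrMr//; lra.
Qed.

Lemma N2Z (c : R[i]) f : L2 f -> N2 (fun t => c * f t) = nc c ^+ 2 * N2 f.
Proof.
move=> [_ If]; rewrite /N2 -RintegralZl//; congr Rintegral; apply/funext => t.
by rewrite Normc.normcM exprMn.
Qed.

Lemma N2B f g : L2 f -> L2 g -> N2 (fun t => f t - g t) =
  N2 f - 2 * complex.Re (cintegral m (fun t => f t * (g t)^*)) + N2 g.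
Proof.
move=> Lf Lg; have [[mf If] [mg Ig]] := (Lf, Lg).
have [Ir _] := L2_mul Lf (L2_conj Lg).
rewrite /N2 /cintegral /= -RintegralZl// -RintegralB//; last exact: integZ.
rewrite -RintegralD//; last first.
  by apply: integB => //; exact: integZ.
by congr Rintegral; apply/funext => t; exact: sqr_ncB.
Qed.

Lemma N2D_le f g : L2 f -> L2 g ->
  N2 (fun t => f t + g t) <= 2 * N2 f + 2 * N2 g.
Proof.
move=> Lf Lg; have [[mf If] [mg Ig]] := (Lf, Lg).
rewrite /N2 -!RintegralZl// -RintegralD//; [|exact: integZ..].
apply: Rintegral_le; first by have [] := L2D Lf Lg.
- by apply: integD; exact: integZ.
- by move=> t; exact: sqr_ncD_le.
Qed.

Lemma N2_bounded f (B : R) : cmeasurable f ->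
  (forall t, nc (f t) <= B) -> N2 f <= B ^+ 2.
Proof.
move=> mf fB; have [_ If] := L2_bounded mf fB.
rewrite -[leRHS]Rintegral1; apply: Rintegral_le => //; first exact: integ_cst.
move=> t /=; rewrite lerXn2r// ?nnegrE ?nc_ge0//.
exact: le_trans (nc_ge0 _) (fB t).
Qed.

Lemma N2_conj f : N2 (fun t => (f t)^*) = N2 f.
Proof. by rewrite /N2; congr Rintegral; apply/funext => t; rewrite nc_conj. Qed.

Lemma N2E f : (N2 f)%:C = cintegral m (fun t => f t * (f t)^*).
Proof.
rewrite -cintegral_real; congr cintegral; apply/funext => t.
by rewrite mul_conjc.
Qed.

End ComplexIntegral.

(** * Measure-preserving maps and uniform continuity *)

Section MeasurePreserving.
Context {R : realType} {G : topologicalZmodType} (m : probability (borel G) R).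
Implicit Types f g : G -> R[i].

Local Notation "'E[ h ]" := (Rintegral m setT (h : borel G -> R))
  (at level 0, h at level 99).
Local Notation integ h := (m.-integrable setT (EFin \o (h : borel G -> R))).

Definition measure_preserving (phi : borel G -> borel G) :=
  measurable_fun setT phi /\
  forall A, measurable A -> m (phi @^-1` A) = m A.

Variable phi : borel G -> borel G.
Hypothesis phi_mp : measure_preserving phi.

Let phi_meas : measurable_fun setT phi. Proof. by case: phi_mp. Qed.

Lemma ge0_integral_mp (h : borel G -> \bar R) : measurable_fun setT h ->
  (forall t, 0 <= h t)%E ->
  (\int[m]_t h (phi t) = \int[m]_t h t)%E.
Proof.
move=> mh h0.
have := @ge0_integral_pushforward _ _ _ _ R _ phi_meas m setT h measurableT mh.
rewrite preimage_setT => <-; last by move=> t _; exact: h0.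
by apply: eq_measure_integral => A mA _; case: phi_mp => _; apply.
Qed.

Lemma integ_mp (h : borel G -> R) : integ h -> integ (fun t => h (phi t)).
Proof.
move=> /integrableP[mh ih]; apply/integrableP; split.
  exact: measurableT_comp mh phi_meas.
rewrite (@ge0_integral_mp (fun t => `|(h t)%:E|)%E)//.
exact: measurableT_comp.
Qed.

Lemma Rintegral_mp (h : borel G -> R) : integ h ->
  'E[fun t => h (phi t)] = 'E[h].
Proof.
move=> ih; rewrite /Rintegral; congr fine.
have := @integral_pushforward _ _ _ _ R _ phi_meas m setT (EFin \o h)
  (measurable_int _ ih).
rewrite preimage_setT => <-//; last exact: integ_mp.
by apply: eq_measure_integral => A mA _; case: phi_mp => _; apply.
Qed.

Lemma cmeasurable_mp f : cmeasurable f -> cmeasurable (fun t => f (phi t)).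
Proof.
by move=> [fr fi]; split;
  [exact: measurableT_comp fr phi_meas|exact: measurableT_comp fi phi_meas].
Qed.

Lemma cintegral_mp f : cintegrable m f ->
  cintegral m (fun t => f (phi t)) = cintegral m f.
Proof.
move=> [fr fi]; rewrite /cintegral; congr (_ +i* _).
- exact: (Rintegral_mp fr).
- exact: (Rintegral_mp fi).
Qed.

Lemma L2_mp f : L2 m f -> L2 m (fun t => f (phi t)).
Proof.
by move=> [mf If]; split; [exact: cmeasurable_mp|exact: integ_mp If].
Qed.

Lemma N2_mp f : L2 m f -> N2 m (fun t => f (phi t)) = N2 m f.
Proof. by move=> [mf If]; exact: (Rintegral_mp If). Qed.

End MeasurePreserving.

(** * Uniformly continuous functions on the group, and compactness *)

Section UniformContinuity.
Context {R : realType} {G : topologicalZmodType}.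
Implicit Types f g : G -> R[i].

(** Uniformity is expressed through the group law: one neighbourhood of 0 serves all points [s], so
    the estimate survives integration over translates. *)
Definition ucont f := forall e : R, 0 < e ->
  exists2 U, nbhs (0 : G) U & forall s u, U u -> nc (f (s + u) - f s) < e.

Lemma continuousDl (a : G) : continuous (fun t : G => a + t).
Proof.
move=> t; apply: (@continuous_comp _ _ _ (fun t => (a, t))
  (fun x : G * G => x.1 + x.2)); last exact: add_continuous.
by apply: cvg_pair => /=; [exact: cvg_cst|exact: cvg_id].
Qed.

Lemma nbhs_shift (a : G) (U : set G) : nbhs (0 : G) U ->
  nbhs a [set t | U (t - a)].
Proof.
move=> U0; have : nbhs a [set t | U (- a + t)].
  by have := @continuousDl (- a) a U; rewrite /= addNr; apply.
by apply: filterS => t /=; rewrite addrC.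
Qed.

Lemma nbhs0_opp (U : set G) : nbhs (0 : G) U -> nbhs (0 : G) [set t | U (- t)].
Proof. by move=> U0; have := @opp_continuous G 0 U; rewrite oppr0; apply. Qed.

Lemma continuous_measurable (h : G -> R) : continuous h ->
  measurable_fun setT (h : borel G -> R).
Proof.
move=> /continuousP ch; apply: (measurability _ (RGenOpens.measurableE R)).
move=> _ [_ [a [b ->] <-]]; rewrite setTI.
by apply: sub_sigma_algebra; apply: ch; exact: interval_open.
Qed.

Lemma continuous_measurable_group (phi : G -> G) : continuous phi ->
  measurable_fun setT (phi : borel G -> borel G).
Proof.
move=> /continuousP ch; apply: (measurability (@open G : set (set (borel G)))) => //.
move=> _ [U oU <-]; rewrite setTI.
by apply: sub_sigma_algebra; exact: ch.
Qed.

Lemma ucont_near f (a : G) (e : R) : ucont f -> 0 < e ->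
  \forall t \near a, nc (f t - f a) < e.
Proof.
move=> uf e0; have [U U0 fU] := uf _ e0.
by apply: filterS (nbhs_shift a U0) => t /= /(fU a); rewrite subrKC.
Qed.

Lemma ucont_Re f : ucont f -> continuous (fun t => complex.Re (f t)).
Proof.
move=> uf a; apply/cvgrPdist_lt => e e0; near=> t.
rewrite distrC; have : nc (f t - f a) < e by near: t; exact: ucont_near.
apply: le_lt_trans; apply: le_trans (nc_Re _).
by case: (f t) (f a) => ? ? [? ?].
Unshelve. all: by end_near. Qed.

Lemma ucont_Im f : ucont f -> continuous (fun t => complex.Im (f t)).
Proof.
move=> uf a; apply/cvgrPdist_lt => e e0; near=> t.
rewrite distrC; have : nc (f t - f a) < e by near: t; exact: ucont_near.
apply: le_lt_trans; apply: le_trans (nc_Im _).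
by case: (f t) (f a) => ? ? [? ?].
Unshelve. all: by end_near. Qed.

Lemma ucont_cmeasurable f : ucont f -> cmeasurable f.
Proof.
by move=> uf; split; apply: continuous_measurable;
  [exact: ucont_Re|exact: ucont_Im].
Qed.

Lemma ucontD f g : ucont f -> ucont g -> ucont (fun t => f t + g t).
Proof.
move=> uf ug e e0; have e20 : 0 < e / 2 by rewrite divr_gt0.
have [[U U0 fU] [V V0 gV]] := (uf _ e20, ug _ e20).
exists (U `&` V); first exact: filterI.
move=> s u [/(fU s) h1 /(gV s) h2].
rewrite opprD addrACA (le_lt_trans (le_ncD _ _))//; lra.
Qed.

Lemma ucontZ (c : R[i]) f : ucont f -> ucont (fun t => c * f t).
Proof.
move=> uf e e0; have e20 : 0 < e / (nc c + 1).
  by rewrite divr_gt0// ltr_wpDl// nc_ge0.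
have [U U0 fU] := uf _ e20; exists U => // s u /(fU s).
rewrite ltr_pdivlMr ?ltr_wpDl ?nc_ge0// -mulrBr Normc.normcM => h.
rewrite (le_lt_trans _ h)// mulrC ler_wpM2l ?nc_ge0// lerDl ler01//.
Qed.

Lemma ucont_shift (a : G) f : ucont f -> ucont (fun t => f (a + t)).
Proof.
move=> uf e e0; have [U U0 fU] := uf _ e0; exists U => // s u /(fU (a + s)).
by rewrite addrA.
Qed.

Lemma ucont_opp f : ucont f -> ucont (fun t => f (- t)).
Proof.
move=> uf e e0; have [U U0 fU] := uf _ e0.
exists [set t | U (- t)]; first exact: nbhs0_opp.
by move=> s u /(fU (- s)); rewrite opprD.
Qed.

Lemma ucont_cst (c : R[i]) : ucont (fun=> c).
Proof.
move=> e e0; exists setT; first exact: filterT.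
by move=> *; rewrite subrr Normc.normc0.
Qed.

Lemma ucont_approx f : (forall e : R, 0 < e ->
  exists2 g, ucont g & forall t, nc (f t - g t) <= e) -> ucont f.
Proof.
move=> H e e0; have e40 : 0 < e / 4 by rewrite divr_gt0.
have [g ug fg] := H _ e40; have [U U0 gU] := ug _ e40.
exists U => // s u /(gU s) h.
have -> : f (s + u) - f s =
    (f (s + u) - g (s + u)) + ((g (s + u) - g s) - (f s - g s)) by ring.
rewrite (le_lt_trans (le_ncD _ _))//.
have := le_ncD (g (s + u) - g s) (- (f s - g s)).
rewrite normcN; have := fg (s + u); have := fg s; lra.
Qed.

Hypothesis G_compact : compact [set: G].

Lemma translates_cover (U : set G) : nbhs (0 : G) U ->
  exists s : seq G, forall t, exists2 a, a \in s & U (t - a).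
Proof.
(* [F] is the filter of properties shared by all large enough finite families; near-covering
   compactness for [F] yields one family that works at every point. *)
move=> U0; pose F (A : set (seq G)) :=
  exists s0 : seq G, forall s : seq G, {subset s0 <= s} -> A s.
have FF : Filter F.
  split; first by exists [::].
  - move=> A B [sA hA] [sB hB]; exists (sA ++ sB) => s sub; split.
    + by apply: hA => x xs; apply: sub; rewrite mem_cat xs.
    + by apply: hB => x xs; apply: sub; rewrite mem_cat xs orbT.
  - by move=> A B AB [sA hA]; exists sA => s /hA; exact: AB.
have near_cov := (compact_near_coveringP _).1 G_compact.
have [|s0 hs0] := near_cov _ F (fun s t => exists2 a, a \in s & U (t - a)) FF.
  move=> a _; exists ([set t | U (t - a)], [set s : seq G | a \in s]) => /=.
    split; first exact: nbhs_shift.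
    by exists [:: a] => s; apply; rewrite mem_head.
  by move=> [t s] /= [Ut sa]; exists a.
by exists s0 => t; exact: hs0.
Qed.

Lemma ucont_bounded f : ucont f -> exists B : R, forall t, nc (f t) <= B.
Proof.
move=> uf; have [U U0 fU] := uf 1 ltr01.
have [s cov] := translates_cover U0.
exists (\sum_(a <- s) nc (f a) + 1) => t.
have [a sa Ut] := cov t; have := fU a _ Ut; rewrite subrKC => h.
have := le_ncB (f t) (f a).
have : nc (f a) <= \sum_(a <- s) nc (f a).
  by rewrite (big_rem _ sa) /= lerDl sumr_ge0// => *; exact: nc_ge0.
lra.
Qed.

(** Continuity of h (s + u) at (a, 0) controls the oscillation for s near a and u near 0.
    Compactness, in its near-covering form over the filter of neighbourhoods of 0, makes the choice
    of u uniform in s. *)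
Lemma continuous_ucont (h : G -> R) : continuous h -> ucont (fun t => (h t)%:C).
Proof.
move=> ch e e0; have near_cov := (compact_near_coveringP _).1 G_compact.
suff hU : \forall u \near (0 : G),
    [set: G] `<=` [set s | nc ((h (s + u))%:C - (h s)%:C) < e].
  exists [set u | [set: G] `<=` [set s | nc ((h (s + u))%:C - (h s)%:C) < e]] => //.
  by move=> s u; apply.
apply: (near_cov G (nbhs (0 : G))
  (fun u s => nc ((h (s + u))%:C - (h s)%:C) < e)) => a _.
have e20 : 0 < e / 2 by rewrite divr_gt0.
  have /cvgrPdist_lt/(_ _ e20) ha := ch a.
  have hD : \forall x \near ((a, 0) : G * G), `|h a - h (x.1 + x.2)| < e / 2.
    by have := @add_continuous G (a, 0) [set y | `|h a - h y| < e / 2];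
       rewrite /= addr0; exact.
  have h1 : \forall x \near ((a, 0) : G * G), `|h a - h x.1| < e / 2.
    exact: (@cvg_fst _ _ (nbhs a) (nbhs (0:G)) _ [set y | `|h a - h y| < e / 2]).
  apply: filterS2 hD h1 => -[s u] k1 k2.
  suff : nc ((h (s + u))%:C - (h s)%:C) < e by [].
  rewrite nc_realB; move: k1 k2 => /= k1 k2.
  rewrite -(subrK (h a) (h (s + u))) -addrA (le_lt_trans (ler_normD _ _))//.
  by rewrite (distrC _ (h a)); lra.
Qed.

End UniformContinuity.

(** * Haar measure *)

Section Haar.
Context {R : realType} {G : topologicalZmodType} (m : probability (borel G) R).
Implicit Types f g : G -> R[i].

Local Notation "'E[ h ]" := (Rintegral m setT (h : borel G -> R))
  (at level 0, h at level 99).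
Local Notation integ h := (m.-integrable setT (EFin \o (h : borel G -> R))).

Hypothesis G_compact : compact [set: G].
Hypothesis m_haar : is_haar m.

Lemma measure_preserving_shift (a : G) :
  measure_preserving m ((fun t : G => a + t) : borel G -> borel G).
Proof.
split; first by apply: continuous_measurable_group; exact: continuousDl.
move=> A mA; case: m_haar => /(_ (- a) A mA) <- _ _.
congr (m _); apply/seteqP; split => [t /= At|_ [t At <-] /=].
  by exists (a + t) => //; rewrite addKr.
by rewrite addNKr.
Qed.

Lemma cintegrable_boundedM f g (B : R) : cmeasurable g ->
  (forall t, nc (g t) <= B) -> cintegrable m f ->
  cintegrable m (fun t => g t * f t).
Proof.
move=> mg gB If; apply: (@cintegrable_le _ _ _ _ (fun t => B * nc (f t))).
- by apply: cmeasurableM => //; exact: cintegrable_meas If.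
- by move=> t; rewrite Normc.normcM ler_wpM2r ?nc_ge0.
- by apply: integZ; exact: integ_nc.
Qed.

Lemma nc_cintegral_le f (h : borel G -> R) : cintegrable m f -> integ h ->
  (forall t, nc (f t) <= h t) -> nc (cintegral m f) <= 'E[h].
Proof.
move=> If ih fh; rewrite (le_trans (le_nc_cintegral If))//.
by apply: Rintegral_le => //; exact: integ_nc.
Qed.

Lemma ucont_reflect (t : G) f : ucont f -> ucont (fun s => f (t - s)).
Proof.
by move=> uf; apply: (@ucont_opp _ _ (fun s => f (t + s))); exact: ucont_shift.
Qed.

Lemma cintegrable_ucontM f g : ucont g -> cintegrable m f ->
  cintegrable m (fun t => g t * f t).
Proof.
move=> ug If; have [B gB] := ucont_bounded G_compact ug.
exact: (cintegrable_boundedM (ucont_cmeasurable ug) gB If).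
Qed.

Lemma ucont_cintegrable f : ucont f -> cintegrable m f.
Proof.
move=> uf; have [B fB] := ucont_bounded G_compact uf.
exact: (cintegrable_bounded m (ucont_cmeasurable uf) fB).
Qed.

Lemma ucont_L2 f : ucont f -> L2 m f.
Proof.
move=> uf; have [B fB] := ucont_bounded G_compact uf.
exact: (L2_bounded m (ucont_cmeasurable uf) fB).
Qed.

Lemma conv_integrand f g t : ucont g -> cintegrable m f ->
  cintegrable m (fun s => g (t - s) * f s).
Proof. by move=> ug; apply: cintegrable_ucontM; exact: ucont_reflect. Qed.

Lemma ucont_conv1 f g : ucont g -> cintegrable m f ->
  ucont (convolution m g f).
Proof.
move=> ug If e e0; set A := 'E[fun t => nc (f t)].
have A0 : 0 <= A by apply: Rintegral_ge0 => t _; exact: nc_ge0.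
have eA : 0 < e / (A + 1) by rewrite divr_gt0// ltr_wpDl.
have [U U0 gU] := ug _ eA; exists U => // t u Uu.
rewrite /convolution -cintegralB; [|exact: conv_integrand..].
rewrite (@le_lt_trans _ _ (e / (A + 1) * A))//; last first.
  by rewrite mulrAC ltr_pdivrMr ?ltr_wpDl// ltr_pM2l// ltrDl.
rewrite -RintegralZl//; last exact: integ_nc.
apply: nc_cintegral_le.
- have := cintegrableD (conv_integrand (t + u) ug If)
    (cintegrableZ (-1) (conv_integrand t ug If)).
  by congr cintegrable; apply/funext => s; rewrite mulN1r.
- by apply: integZ; exact: integ_nc.
- move=> s; rewrite -mulrBl Normc.normcM ler_wpM2r ?nc_ge0//.
  by rewrite addrAC ltW// gU.
Qed.

Lemma cintegrable_restrict f (A : set (borel G)) : measurable A ->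
  cintegrable m f -> cintegrable m (fun t => (\1_A t : R)%:C * f t).
Proof.
move=> mA; apply: (@cintegrable_boundedM _ _ 1).
- split => /=; last exact: measurable_cst.
  exact: measurable_indic.
- by move=> t; rewrite nc_real ger0_norm ?ler0n// indicE; case: (_ \in _).
Qed.

(* Fubini's theorem for the kernel [g (u - s)]: the Borel sigma-algebra of
   [G * G] may exceed the product one, so the domain of [b] is cut into finitely
   many pieces on which [g (u - s)] is nearly constant in [s]. *)
Lemma convolution_adjoint a b g : cintegrable m a -> cintegrable m b ->
  ucont g ->
  cintegral m (fun s => convolution m (fun t => g (- t)) a s * b s) =
  cintegral m (fun u => convolution m g b u * a u).
Proof.
move=> Ia Ib ug; have ug' := ucont_opp ug.
pose Phi := convolution m (fun t => g (- t)) a.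
pose D b := cintegral m (fun s => Phi s * b s) -
            cintegral m (fun u => convolution m g b u * a u).
have uPhi : ucont Phi by exact: ucont_conv1.
pose A := 'E[fun t => nc (a t)].
have A0 : 0 <= A by apply: Rintegral_ge0 => t _; exact: nc_ge0.
pose N b := 'E[fun t => nc (b t)].
have N0 b' : 0 <= N b' by apply: Rintegral_ge0 => t _; exact: nc_ge0.
have DD b1 b2 : cintegrable m b1 -> cintegrable m b2 ->
    D (fun t => b1 t + b2 t) = D b1 + D b2.
  move=> I1 I2; rewrite /D.
  rewrite (_ : (fun s => Phi s * (b1 s + b2 s)) =
    (fun s => Phi s * b1 s + Phi s * b2 s)); last first.
    by apply/funext => s; rewrite mulrDr.
  rewrite cintegralD; [|exact: cintegrable_ucontM..].
  rewrite (_ : (fun u => convolution m g (fun t => b1 t + b2 t) u * a u) =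
    (fun s => convolution m g b1 s * a s + convolution m g b2 s * a s)).
    rewrite cintegralD; first by rewrite opprD addrACA.
    - by apply: cintegrable_ucontM => //; exact: ucont_conv1.
    - by apply: cintegrable_ucontM => //; exact: ucont_conv1.
  apply/funext => u; rewrite -mulrDl; congr (_ * _).
  rewrite /convolution -cintegralD; [|exact: conv_integrand..].
  by congr cintegral; apply/funext => s; rewrite mulrDr.
(* For [b] supported near [c], both iterated integrals are within e * A * N b of [Phi c] times the
   integral of [b], because g (u - s) is within e of g (u - c) on the support. *)
have D_small (e : R) : 0 < e -> exists2 U, nbhs (0 : G) U /\ open U &
    forall c b, cintegrable m b -> (forall s, ~ U (s - c) -> b s = 0) ->
      nc (D b) <= 2 * e * A * N b.
  move=> e0; have [U0 nU0 gU0] := ug _ e0.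
  have nU : nbhs (0 : G) [set t | U0 (- t)] by exact: nbhs0_opp.
  exists ([set t | U0 (- t)]°).
    by split; [exact: nbhs_interior|exact: open_interior].
  move=> c b' Ib' b'0.
  have gsmall u s : nc ((g (u - s) - g (u - c)) * b' s) <= e * nc (b' s).
    have [->|b's] := eqVneq (b' s) 0; first by rewrite mulr0 Normc.normc0 mulr0.
    rewrite Normc.normcM ler_wpM2r ?nc_ge0// ltW//.
    have Us : U0 (- (s - c)).
      apply: (@interior_subset _ [set t | U0 (- t)] (s - c)).
      by apply: contrapT => /b'0 /eqP; exact/negP.
    by have := gU0 (u - c) _ Us; rewrite opprB addrA subrK.
  have PhiE s : Phi s = cintegral m (fun u => g (u - s) * a u).
    by rewrite /Phi /convolution; under eq_fun do rewrite opprB.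
  have Ig s : cintegrable m (fun u => g (u - s) * a u).
    apply: cintegrable_ucontM => //.
    by have := ucont_shift (- s) ug; under eq_fun do rewrite addrC.
  have h1 : nc (cintegral m (fun s => Phi s * b' s) -
                Phi c * cintegral m b') <= e * A * N b'.
    rewrite -cintegralZ// -cintegralB; [|exact: cintegrable_ucontM|
      exact: cintegrableZ].
    rewrite /N -RintegralZl//; last exact: integ_nc.
    apply: nc_cintegral_le.
    - have := cintegrableD (cintegrable_ucontM uPhi Ib')
        (cintegrableZ (- Phi c) Ib').
      by congr cintegrable; apply/funext => s; rewrite mulNr.
    - by apply: integZ; exact: integ_nc.
    - move=> s; rewrite -mulrBl.
      have [->|b's] := eqVneq (b' s) 0; first by rewrite mulr0 Normc.normc0 mulr0.
      rewrite Normc.normcM ler_wpM2r ?nc_ge0// !PhiE -cintegralB//.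
      rewrite /A -RintegralZl//; last exact: integ_nc.
      apply: nc_cintegral_le.
      + have := cintegrableD (Ig s) (cintegrableZ (-1) (Ig c)).
        by congr cintegrable; apply/funext => u; rewrite mulN1r.
      + by apply: integZ; exact: integ_nc.
      + move=> u; rewrite -mulrBl Normc.normcM ler_wpM2r ?nc_ge0//.
        have := gsmall u s; rewrite Normc.normcM ler_pM2r//.
        by rewrite nc_gt0.
  have Iconv : cintegrable m (fun u => convolution m g b' u * a u).
    by apply: cintegrable_ucontM => //; exact: ucont_conv1.
  have h2 : nc (cintegral m (fun u => convolution m g b' u * a u) -
                cintegral m b' * Phi c) <= e * A * N b'.
    rewrite PhiE -cintegralZ// -cintegralB//; last exact: cintegrableZ.
    rewrite mulrAC /A -RintegralZl//; last exact: integ_nc.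
    apply: nc_cintegral_le.
    - have := cintegrableD Iconv (cintegrableZ (- cintegral m b') (Ig c)).
      by congr cintegrable; apply/funext => u; rewrite mulNr.
    - by apply: integZ; exact: integ_nc.
    - move=> u; rewrite mulrA -mulrBl Normc.normcM ler_wpM2r ?nc_ge0//.
      rewrite /convolution mulrC -cintegralZ// -cintegralB.
      + rewrite /N -RintegralZl//; last exact: integ_nc.
        apply: nc_cintegral_le.
        * have := cintegrableD (conv_integrand u ug Ib')
            (cintegrableZ (- g (u - c)) Ib').
          by congr cintegrable; apply/funext => s; rewrite mulNr.
        * by apply: integZ; exact: integ_nc.
        * by move=> s; rewrite -mulrBl; exact: gsmall.
      + exact: conv_integrand.
      + exact: cintegrableZ.
  have -> : D b' = (cintegral m (fun s => Phi s * b' s) -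
                Phi c * cintegral m b') -
    (cintegral m (fun u => convolution m g b' u * a u) -
                cintegral m b' * Phi c) by rewrite /D; ring.
  rewrite (le_trans (le_ncD _ _))// normcN; lra.
have D_le (e : R) : 0 < e -> nc (D b) <= 2 * e * A * N b.
  move=> e0; have [U [U0 oU] HU] := D_small e e0.
  have [cs cov] := translates_cover G_compact U0.
  have {cov} : forall s, b s != 0 -> exists2 c, c \in cs & U (s - c).
    by move=> s _; exact: cov.
  (* Induction on the covering translates: the function is cut into its restrictions to the first
     translate and to the complement. [N] is additive over this splitting, so the errors add up to
     the same bound whatever the number of pieces. *)
  move: (b) Ib; elim: cs => [b' Ib' b'0|c cs IH b' Ib' b'cs].
    have -> : b' = fun=> 0.
      by apply/funext => s; apply/eqP/negPn/negP => /b'0[].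
    have -> : D (fun=> 0) = 0.
      have I0 : cintegrable m (fun _ : G => 0).
        by apply: (@cintegrable_bounded _ _ _ _ 0) => [|t];
          [exact: cmeasurable_cst|rewrite Normc.normc0].
      have := DD _ _ I0 I0; under [X in D X = _ -> _]eq_fun do rewrite addr0.
      by move=> /eqP; rewrite -subr_eq0 opprD addNKr oppr_eq0 => /eqP.
    by rewrite Normc.normc0 !mulr_ge0// ltW.
  pose V : set (borel G) := [set s | U (s - c)].
  have mV : measurable V.
    apply: sub_sigma_algebra; have /continuousP := @continuousDl G (- c).
    move=> /(_ _ oU); congr open.
    by apply/seteqP; split => t /=; rewrite addrC.
  pose b1 t := (\1_V t : R)%:C * b' t.
  pose b2 t := (\1_(~` V) t : R)%:C * b' t.
  have Ib1 : cintegrable m b1 by exact: cintegrable_restrict.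
  have Ib2 : cintegrable m b2.
    by apply: cintegrable_restrict => //; exact: measurableC.
  have b'E : b' = fun t => b1 t + b2 t.
    apply/funext => t; rewrite /b1 /b2 -mulrDl !indicE in_setC.
    by case: (t \in V); rewrite /= ?addr0 ?add0r mul1r.
  have NE : N b' = N b1 + N b2.
    rewrite /N -RintegralD//; [|exact: integ_nc..].
    congr Rintegral; apply/funext => t; rewrite /b1 /b2 !indicE in_setC.
    by case: (t \in V); rewrite /= ?mul0r ?mul1r ?Normc.normc0 ?addr0 ?add0r.
  rewrite {1}b'E DD// (le_trans (le_ncD _ _))// NE mulrDr lerD//.
  - apply: (HU c) => // s Us; rewrite /b1 indicE memNset ?mul0r//.
  - apply: IH => // s; rewrite /b2 indicE in_setC.
    have [/set_mem Vs|] := boolP (s \in V); first by rewrite mul0r eqxx.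
    move=> /negP Vs; rewrite mul1r => /b'cs[d].
    rewrite inE => /predU1P[->|dcs] Ud; last by exists d.
    by exfalso; apply: Vs; rewrite inE.
suff : nc (D b) <= 0.
  rewrite le_eqVlt ltNge nc_ge0 orbF nc_eq0 subr_eq0 => /eqP ->//.
apply/ler_addgt0Pl => e e0; rewrite addr0.
have ANgt0 : 0 < 2 * (A * N b) + 1 by rewrite ltr_wpDl// mulr_ge0// mulr_ge0.
have := D_le (e / (2 * (A * N b) + 1)) (divr_gt0 e0 ANgt0).
move=> h; rewrite (le_trans h)//.
have -> : 2 * (e / (2 * (A * N b) + 1)) * A * N b =
  e * (2 * (A * N b)) / (2 * (A * N b) + 1) by ring.
by rewrite ler_pdivrMr// ler_pM2l// lerDl.
Qed.

End Haar.

(** * Regularity, inversion invariance, and density of continuous functions in L^2 *)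

Section HaarL2.
Context {R : realType} {G : topologicalZmodType} (m : probability (borel G) R).
Implicit Types f g : G -> R[i].

Local Notation "'E[ h ]" := (Rintegral m setT (h : borel G -> R))
  (at level 0, h at level 99).
Local Notation integ h := (m.-integrable setT (EFin \o (h : borel G -> R))).

Hypothesis G_hausdorff : hausdorff_space G.
Hypothesis G_compact : compact [set: G].
Hypothesis m_haar : is_haar m.

Definition mreal (A : set (borel G)) : R := fine (m A).

Lemma mrealE (A : set (borel G)) : measurable A -> (mreal A)%:E = m A.
Proof. by move=> mA; rewrite /mreal fineK// fin_num_measure. Qed.

Lemma mreal_le (A B : set (borel G)) : measurable A -> measurable B ->
  A `<=` B -> mreal A <= mreal B.
Proof.
move=> mA mB AB; rewrite -lee_fin !mrealE//.
by apply: le_measure => //; rewrite inE.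
Qed.

Lemma Rintegral_mreal (A : set (borel G)) : measurable A ->
  'E[\1_A] = mreal A.
Proof. by move=> mA; rewrite /Rintegral integral_indic// setIT. Qed.

Lemma integ_indic (A : set (borel G)) : measurable A -> integ \1_A.
Proof.
move=> mA; apply: (@integ_le _ _ _ _ (cst 1)); last exact: integ_cst.
- exact: measurable_indic.
- by move=> t; rewrite ger0_norm ?ler0n// indicE; case: (_ \in _).
Qed.

Lemma open_borel (U : set G) : open U -> measurable (U : set (borel G)).
Proof. exact: sub_sigma_algebra. Qed.

Lemma closed_borel (U : set G) : closed U -> measurable (U : set (borel G)).
Proof.
by move=> cU; rewrite -[U]setCK; apply: measurableC; apply: open_borel;
  exact: closed_openC.
Qed.

Lemma outer_regular (A : set G) (e : R) : measurable (A : set (borel G)) ->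
  0 < e -> exists2 U : set G, open U /\ A `<=` U & mreal U < mreal A + e.
Proof.
move=> mA e0; case: m_haar => _ /(_ A mA) mAE _.
have H := @lb_ereal_inf_adherent R
  [set m U | U in [set U : set G | open U /\ A `<=` U]] e e0.
rewrite -mAE in H.
have [|_ [U [oU AU] <-] UA] := H _; first exact: fin_num_measure.
exists U => //; rewrite -lte_fin EFinD !mrealE//; exact: open_borel.
Qed.

Lemma inner_regular_open (U : set G) (e : R) : open U -> 0 < e ->
  exists2 K : set G, compact K /\ K `<=` U & mreal U < mreal K + e.
Proof.
move=> oU e0; case: m_haar => _ _ /(_ U oU) mUE.
have H := @ub_ereal_sup_adherent R
  [set m K | K in [set K : set G | compact K /\ K `<=` U]] e e0.
rewrite -mUE in H.
have [|_ [K [cK KU] <-] UK] := H _; first by apply: fin_num_measure; exact: open_borel.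
exists K => //; rewrite -lte_fin EFinD !mrealE//; last first.
- exact: open_borel.
- by apply: closed_borel; exact: compact_closed.
- by rewrite -lteBlDr.
Qed.

Lemma urysohn_group (K V : set G) : closed K -> open V -> K `<=` V ->
  exists h : G -> R, [/\ continuous h, forall t, 0 <= h t <= 1,
    forall t, K t -> h t = 1 & forall t, ~ V t -> h t = 0].
Proof.
move=> cK oV KV.
have nG := compact_normal G_hausdorff G_compact.
have := (@normal_separatorP R G).1 nG (~` V) K (open_closedC oV) cK.
move=> /(_ _)/(@uniform_separatorP _ R)[].
  by apply/seteqP; split => // t [/= Vt /KV].
move=> h [ch h01 h0 h1]; exists h; split => //.
- by move=> t; have /(_ (h t)) := h01; rewrite /= in_itv /=; apply; exists t.
- by move=> t Kt; apply: h1; exists t.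
- by move=> t Vt; apply: h0; exists t.
Qed.

(** This is [convolution_adjoint] with both functions equal to 1: by translation invariance the two
    inner integrals are constants, the integral of f and that of its reflection. *)
Lemma cintegral_ucont_opp f : ucont f ->
  cintegral m (fun t => f (- t)) = cintegral m f.
Proof.
move=> uf; have I1 : cintegrable m (fun _ : G => 1).
  by apply: ucont_cintegrable => //; exact: ucont_cst.
have := convolution_adjoint G_compact I1 I1 uf; rewrite /convolution.
have uf' := ucont_opp uf.
have e1 s : cintegral m (fun u => f (- (s - u)) * 1) = cintegral m f.
  rewrite -[RHS](cintegral_mp (measure_preserving_shift m_haar (- s))).
    by congr cintegral; apply/funext => u; rewrite mulr1 opprB addrC.
  exact: ucont_cintegrable.
have e2 s : cintegral m (fun u => f (s - u) * 1) =
    cintegral m (fun u => f (- u)).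
  rewrite -[RHS](cintegral_mp (measure_preserving_shift m_haar (- s))).
    by congr cintegral; apply/funext => u; rewrite mulr1 opprD opprK.
  exact: ucont_cintegrable.
under eq_fun do rewrite e1; under [in X in _ = X -> _]eq_fun do rewrite e2.
have cc c : cintegral m (fun _ : G => c * 1) = c.
  by rewrite cintegralZ// (cintegral_real m (cst 1)) Rintegral1 mulr1.
by rewrite !cc.
Qed.

Let borel_opp : measurable_fun setT ((fun t : G => - t) : borel G -> borel G).
Proof. by apply: continuous_measurable_group; exact: opp_continuous. Qed.

(** A Urysohn function h is squeezed between a compact K inside -U and -U itself. Then m K is at
    most the integral of h, which equals that of its reflection and so is at most m U; inner
    regularity lets m K approach m (-U). *)
Let mopp_open (U : set G) : open U -> mreal (-%R @^-1` U) <= mreal U.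
Proof.
move=> oU; apply/ler_addgt0Pr => e e0.
have oU' : open (-%R @^-1` U) by move/continuousP : (@opp_continuous G); exact.
have [K [cK KU]] := inner_regular_open oU' e0.
move=> /ltW/le_trans; apply; rewrite lerD2r.
have clK := compact_closed G_hausdorff cK.
have [h [ch h01 h1 h0]] := urysohn_group clK oU' KU.
have uh := continuous_ucont G_compact ch.
have mK := closed_borel clK; have mU := open_borel oU.
have [ih _] := ucont_cintegrable m G_compact uh.
have := cintegral_ucont_opp uh; rewrite !(cintegral_real m) => /complexI hE.
have [ih' _] := ucont_cintegrable m G_compact (ucont_opp uh).
rewrite -!Rintegral_mreal// (@le_trans _ _ 'E[h])//.
  apply: Rintegral_le => //; first exact: integ_indic.
  move=> t; rewrite indicE; have [/set_mem/h1 ->//|_] := boolP (t \in _).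
  by have /andP[] := h01 t.
rewrite -hE; apply: Rintegral_le => //; first exact: integ_indic.
move=> t; rewrite indicE; have [_|] := boolP (t \in _).
  by have /andP[] := h01 (- t).
by move=> /negP Ut; rewrite h0//= opprK => Ut'; apply: Ut; rewrite inE.
Qed.

(** Outer regularity carries the inequality from open sets to Borel sets. Reflection being an
    involution, the inequality for the preimage of A is the reverse inequality for A. *)
Lemma measure_preserving_opp :
  measure_preserving m ((fun t : G => - t) : borel G -> borel G).
Proof.
split => // A mA.
have mopp B : measurable (B : set (borel G)) ->
    measurable (-%R @^-1` B : set (borel G)).
  by move=> mB; have := borel_opp measurableT mB; rewrite setTI.
have le B : measurable (B : set (borel G)) -> mreal (-%R @^-1` B) <= mreal B.
  move=> mB; apply/ler_addgt0Pr => e e0.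
  have [U [oU BU] UB] := outer_regular mB e0.
  apply: le_trans (ltW UB); apply: le_trans (mopp_open oU).
  have mU := open_borel oU.
  by apply: mreal_le => [||t /BU//]; exact: mopp.
rewrite -!mrealE//; last exact: mopp.
congr EFin; apply: le_anti; rewrite le//=.
have := le _ (mopp _ mA); congr (mreal _ <= _).
by apply/seteqP; split => t /=; rewrite opprK.
Qed.

Lemma measure_preserving_reflect (a : G) :
  measure_preserving m ((fun t : G => a - t) : borel G -> borel G).
Proof.
have [mo eo] := measure_preserving_opp.
have [ms es] := measure_preserving_shift m_haar a.
split; first exact: measurableT_comp ms mo.
move=> A mA; rewrite -(es A mA); apply: eo.
by have := ms measurableT _ mA; rewrite setTI.
Qed.

(** Membership in the L^2 closure of the uniformly continuous functions. As a predicate on f it can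
    be propagated from indicators to simple functions, then to nonnegative and to all L^2
    functions. *)
Definition ucont_dense f := L2 m f /\
  forall e : R, 0 < e -> exists2 g, ucont g & N2 m (fun t => f t - g t) < e.

Lemma ucont_denseD f g : ucont_dense f -> ucont_dense g ->
  ucont_dense (fun t => f t + g t).
Proof.
move=> [Lf Hf] [Lg Hg]; split; first exact: L2D.
move=> e e0; have e40 : 0 < e / 4 by rewrite divr_gt0.
have [[p up fp] [q uq gq]] := (Hf _ e40, Hg _ e40).
exists (fun t => p t + q t); first exact: ucontD.
have [Lp Lq] := (ucont_L2 m G_compact up, ucont_L2 m G_compact uq).
under eq_fun do rewrite opprD addrACA.
rewrite (le_lt_trans (N2D_le (L2B Lf Lp) (L2B Lg Lq)))//; lra.
Qed.

Lemma ucont_denseZ (c : R[i]) f : ucont_dense f -> ucont_dense (fun t => c * f t).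
Proof.
move=> [Lf Hf]; split; first exact: L2Z.
move=> e e0; have c1 : 0 < nc c ^+ 2 + 1 by rewrite ltr_wpDl// sqr_ge0.
have [p up fp] := Hf _ (divr_gt0 e0 c1).
exists (fun t => c * p t); first exact: ucontZ.
have Lp := ucont_L2 m G_compact up.
under eq_fun do rewrite -mulrBr.
rewrite N2Z; last exact: L2B.
move: fp; rewrite ltr_pdivlMr// => /(le_lt_trans _); apply.
by rewrite mulrC ler_wpM2l ?N2_ge0// lerDl ler01.
Qed.

Lemma ucont_dense_lim f : L2 m f ->
  (forall e : R, 0 < e -> exists2 g, ucont_dense g & N2 m (fun t => f t - g t) < e) ->
  ucont_dense f.
Proof.
move=> Lf H; split => // e e0; have e40 : 0 < e / 4 by rewrite divr_gt0.
have [g [Lg Hg] fg] := H _ e40; have [p up gp] := Hg _ e40.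
exists p => //; have Lp := ucont_L2 m G_compact up.
have := N2D_le (L2B Lf Lg) (L2B Lg Lp).
under eq_fun do rewrite addrA subrK.
move=> h; rewrite (le_lt_trans h)//; lra.
Qed.

(** Let open U and W contain A and its complement, each with excess measure below e / 2. A Urysohn
    function between the complement of W and U differs from the indicator only on the intersection
    of U and W, whose measure m U + m W - 1 is below e. *)
Lemma ucont_dense_indic (A : set G) : measurable (A : set (borel G)) ->
  ucont_dense (fun t => (\1_A t : R)%:C).
Proof.
move=> mA; have LA (B : set G) : measurable (B : set (borel G)) ->
    L2 m (fun t => (\1_B t : R)%:C).
  move=> mB; apply: (@L2_bounded _ _ _ _ 1).
    by split => /=; [exact: measurable_indic|exact: measurable_cst].
  by move=> t; rewrite nc_real ger0_norm ?ler0n// indicE; case: (_ \in _).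
split; first exact: LA.
move=> e e0; have e20 : 0 < e / 2 by rewrite divr_gt0.
have [U [oU AU] UA] := outer_regular mA e20.
have mA' := measurableC mA.
have [W [oW AW] WA] := outer_regular mA' e20.
have KU : ~` W `<=` U.
  by move=> t Wt; apply: AU; apply: contrapT => At; apply: Wt; exact: AW.
have [h [ch h01 h1 h0]] := urysohn_group (open_closedC oW) oU KU.
have uh := continuous_ucont G_compact ch.
exists (fun t => (h t)%:C) => //.
have [mU mW] := (open_borel oU, open_borel oW).
have mUW : measurable (U `&` W : set (borel G)) by exact: measurableI.
have UW t : U t \/ W t.
  have [At|At] := pselect (A t); [left; exact: AU|right; exact: AW].
have hle t : nc ((\1_A t : R)%:C - (h t)%:C) ^+ 2 <= \1_(U `&` W) t.
  rewrite nc_realB real_normK ?num_real// !indicE in_setI.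
  have [/set_mem Ut|] := boolP (t \in U); last first.
    move=> /negP nU; rewrite h0 ?subr0 => [|Ut]; last by apply: nU; rewrite inE.
    rewrite memNset ?expr0n// => At; by apply: nU; rewrite inE; exact: AU.
  have [/set_mem Wt|] := boolP (t \in W).
    have /andP[h0t h1t] := h01 t; case: (t \in A) => /=; nra.
  move=> /negP nW; have nWt : ~ W t by move=> Wt; apply: nW; rewrite inE.
  rewrite h1// mem_set ?subrr ?expr0n//.
  by apply: contrapT => At; apply: nWt; exact: AW.
have ihUW := integ_indic mUW.
have : N2 m (fun t => (\1_A t : R)%:C - (h t)%:C) <= mreal (U `&` W).
  rewrite -Rintegral_mreal//; apply: Rintegral_le => //.
  have [] // := L2B (LA _ mA) (ucont_L2 m G_compact uh).
move=> /le_lt_trans; apply.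
have : mreal U + mreal W = 1 + mreal (U `&` W).
  rewrite -!Rintegral_mreal// -(@Rintegral1 _ _ m 1) -!RintegralD//.
  - congr Rintegral; apply/funext => t. rewrite ?indicE in_setI.
    have [|] := UW t; move/mem_set => ->; case: (t \in _) => /=; ring.
  - exact: integ_cst.
  - exact: integ_indic.
  - exact: integ_indic.
have : mreal A + mreal (~` A) = 1.
  rewrite -!Rintegral_mreal// -RintegralD//; [|exact: integ_indic..].
  rewrite -[RHS](@Rintegral1 _ _ m 1).
  congr Rintegral; apply/funext => t; rewrite ?indicE in_setC.
  by case: (t \in A) => /=; ring.
lra.
Qed.

Import HBNNSimple.

Let ucont_dense_nnsfun (s : {nnsfun borel G >-> R}) :
  ucont_dense (fun t => (s t)%:C).
Proof.
rewrite (_ : (fun t => (s t)%:C) = (fun t : G =>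
  \sum_(i < size (finmap.enum_fset (fset_set (range s))))
    ((finmap.enum_fset (fset_set (range s)))`_i)%:C *
    (\1_(s @^-1` [set (finmap.enum_fset (fset_set (range s)))`_i]) t : R)%:C)).
  move: (index_enum _) => r; elim: r => [|i r IH].
    under eq_fun do rewrite big_nil.
    split; first exact: L2_cst.
    move=> e e0; exists (fun=> 0); first exact: ucont_cst.
    under eq_fun do rewrite subrr.
    by rewrite /N2 Normc.normc0 expr0n Rintegral1.
  under eq_fun do rewrite big_cons.
  apply: ucont_denseD => //; apply: ucont_denseZ; apply: ucont_dense_indic.
  have ms : measurable_fun setT (s : borel G -> R) by exact: measurable_funP.
  have := ms measurableT _
    (measurable_set1 (finmap.enum_fset (fset_set (range s)))`_i).
  by rewrite setTI.
apply/funext => t; rewrite {1}fimfunEord rmorph_sum; apply: eq_bigr => i _.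
by rewrite rmorphM.
Qed.

Let ucont_dense_ge0 (h : borel G -> R) : measurable_fun setT h ->
  (forall t, 0 <= h t) -> integ (fun t => h t ^+ 2) ->
  ucont_dense (fun t => (h t)%:C).
Proof.
move=> mh h0 ih; have mEh : measurable_fun setT (EFin \o h).
  exact/measurable_EFinP.
pose s_ := nnsfun_approx measurableT mEh.
have s_le n t : s_ n t <= h t.
  rewrite /s_ nnsfun_approxE -lee_fin.
  by apply: le_approx => // x _; rewrite lee_fin.
have s_ge0 n t : 0 <= s_ n t by [].
have s_cvg t : s_ ^~ t @ \oo --> h t.
  have := @cvg_nnsfun_approx _ _ _ _ measurableT _ mEh _ t I.
  move=> /(_ _)/fine_cvgP[]; first by move=> x _; rewrite lee_fin.
  by move=> _.
have ms n : measurable_fun setT (s_ n : borel G -> R) by exact: measurable_funP.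
apply: ucont_dense_lim.
  split; first by split => //=; exact: measurable_cst.
  by under eq_fun do rewrite nc_real real_normK ?num_real//.
move=> e e0.
(* The simple functions converge to h pointwise and (h - s_n)^2 <= h^2, so dominated convergence
   gives convergence in L^2. *)
pose F n t := ((h t - s_ n t) ^+ 2)%:E.
have [|||||_ _ +] := @dominated_convergence _ _ _ m setT measurableT F (cst 0%E)
   (fun t => (h t ^+ 2)%:E) .
- move=> n; apply/measurable_EFinP; apply: measurable_funX.
  exact: measurable_funB.
- exact: measurable_cst.
- apply: aeW => t _; rewrite /F; apply/fine_cvgP; split; first exact: nearW.
  have d0 : (fun n => h t - s_ n t) @ \oo --> 0.
    by rewrite -(subrr (h t)); apply: cvgB; [exact: cvg_cst|exact: s_cvg].
  have d2 := cvgM d0 d0; rewrite mulr0 in d2.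
  rewrite (_ : fine \o _ = (fun n => (h t - s_ n t) * (h t - s_ n t))).
    exact: d2.
  by apply/funext => n; rewrite /= expr2.
- exact: ih.
- apply: aeW => t n _; rewrite /F /= lee_fin ger0_norm ?sqr_ge0//.
  have := s_le n t; have := s_ge0 n t; have := h0 t; nra.
rewrite integral_cst// mul0e => /fine_cvgP[_].
move=> /cvgrPdist_lt/(_ _ e0)[n _ /(_ n (leqnn n))] /=.
rewrite sub0r normrN => Hn; exists (fun t => (s_ n t)%:C).
  exact: ucont_dense_nnsfun.
rewrite /N2 (_ : (fun t => _) = (fun t : borel G => (h t - s_ n t) ^+ 2)).
  by apply: le_lt_trans Hn; rewrite ler_norm.
by apply/funext => t; rewrite nc_realB real_normK ?num_real.
Qed.

Lemma L2_ucont_dense f : L2 m f -> ucont_dense f.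
Proof.
move=> [[fr fi] If].
have pos (h : borel G -> R) : measurable_fun setT h ->
    (forall t, `|h t| <= nc (f t)) -> ucont_dense (fun t => (h t)%:C).
  move=> mh hf.
  have H (k : borel G -> R) : measurable_fun setT k -> (forall t, 0 <= k t) ->
      (forall t, k t <= nc (f t)) -> ucont_dense (fun t => (k t)%:C).
    move=> mk k0 kf; apply: ucont_dense_ge0 => //.
    apply: (integ_le _ _ If); first exact: measurable_funX.
    move=> t; rewrite ger0_norm ?sqr_ge0// lerXn2r// nnegrE ?nc_ge0//.
  rewrite (_ : (fun t => _) = (fun t => (h^\+ t)%:C + (-1) * (h^\- t)%:C)).
    apply: ucont_denseD; last apply: ucont_denseZ.
    - apply: H => [|//|t]; first exact: measurable_funrpos.
      by rewrite /funrpos ge_max nc_ge0 (le_trans (ler_norm _)).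
    - apply: H => [|//|t]; first exact: measurable_funrneg.
      by rewrite /funrneg ge_max nc_ge0 (le_trans (ler_norm _))// normrN.
  apply/funext => t; by rewrite mulN1r -rmorphB -{1}(funrposBneg h).
rewrite (_ : f = (fun t => (complex.Re (f t))%:C + 'i * (complex.Im (f t))%:C)).
  apply: ucont_denseD; last apply: ucont_denseZ.
  - by apply: pos => // t; exact: nc_Re.
  - by apply: pos => // t; exact: nc_Im.
by apply/funext => t; exact: complexE.
Qed.

End HaarL2.

(** * Convolution and Fourier coefficients in L^2 *)

Section ConvolutionL2.
Context {R : realType} {G : topologicalZmodType} (m : probability (borel G) R).
Implicit Types f g : G -> R[i].

Hypothesis G_hausdorff : hausdorff_space G.
Hypothesis G_compact : compact [set: G].
Hypothesis m_haar : is_haar m.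

Local Notation "f ** g" := (convolution m f g) (at level 40, left associativity).

Let mp_reflect := measure_preserving_reflect G_hausdorff G_compact m_haar.

Lemma L2_reflect (t : G) f : L2 m f -> L2 m (fun s => f (t - s)).
Proof. exact: L2_mp (mp_reflect t) _. Qed.

Lemma N2_reflect (t : G) f : L2 m f -> N2 m (fun s => f (t - s)) = N2 m f.
Proof. exact: N2_mp (mp_reflect t) _. Qed.

Lemma cintegral_reflect (t : G) f : cintegrable m f ->
  cintegral m (fun s => f (t - s)) = cintegral m f.
Proof. exact: cintegral_mp (mp_reflect t) _. Qed.

Lemma cintegrable_conv t f g : L2 m f -> L2 m g ->
  cintegrable m (fun s => f (t - s) * g s).
Proof. by move=> Lf Lg; apply: L2_mul => //; exact: L2_reflect. Qed.

Lemma nc_conv_le t f g : L2 m f -> L2 m g ->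
  nc ((f ** g) t) ^+ 2 <= N2 m f * N2 m g.
Proof.
move=> Lf Lg; rewrite -(N2_reflect t Lf).
by apply: cauchy_schwarz => //; exact: L2_reflect.
Qed.

Lemma convC f g : L2 m f -> L2 m g -> f ** g = g ** f.
Proof.
move=> Lf Lg; apply/funext => t; rewrite /convolution.
rewrite -(@cintegral_reflect t); last exact: cintegrable_conv.
by congr cintegral; apply/funext => s; rewrite opprB addrC subrK mulrC.
Qed.

Lemma convDl f1 f2 g : L2 m f1 -> L2 m f2 -> L2 m g ->
  (fun t => f1 t + f2 t) ** g = (fun t => (f1 ** g) t + (f2 ** g) t).
Proof.
move=> L1 L2' Lg; apply/funext => t; rewrite /convolution.
rewrite -cintegralD; [|exact: cintegrable_conv..].
by congr cintegral; apply/funext => s; rewrite mulrDl.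
Qed.

Lemma convZl (c : R[i]) f g : L2 m f -> L2 m g ->
  (fun t => c * f t) ** g = (fun t => c * (f ** g) t).
Proof.
move=> Lf Lg; apply/funext => t; rewrite /convolution.
rewrite -cintegralZ; last exact: cintegrable_conv.
by congr cintegral; apply/funext => s; rewrite mulrA.
Qed.

Lemma convBl f1 f2 g : L2 m f1 -> L2 m f2 -> L2 m g ->
  (fun t => f1 t - f2 t) ** g = (fun t => (f1 ** g) t - (f2 ** g) t).
Proof.
move=> L1 L2' Lg; apply/funext => t; rewrite /convolution.
rewrite -cintegralB; [|exact: cintegrable_conv..].
by congr cintegral; apply/funext => s; rewrite mulrBl.
Qed.

Lemma convZr (c : R[i]) f g : L2 m f -> L2 m g ->
  f ** (fun t => c * g t) = (fun t => c * (f ** g) t).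
Proof.
by move=> Lf Lg; rewrite convC ?convZl ?(convC Lf)//; exact: L2Z.
Qed.

Lemma convDr f g1 g2 : L2 m f -> L2 m g1 -> L2 m g2 ->
  f ** (fun t => g1 t + g2 t) = (fun t => (f ** g1) t + (f ** g2) t).
Proof.
by move=> Lf L1 L2'; rewrite convC ?convDl ?(convC Lf)//; exact: L2D.
Qed.

Lemma convBr f g1 g2 : L2 m f -> L2 m g1 -> L2 m g2 ->
  f ** (fun t => g1 t - g2 t) = (fun t => (f ** g1) t - (f ** g2) t).
Proof.
by move=> Lf L1 L2'; rewrite convC ?convBl ?(convC Lf)//; exact: L2B.
Qed.

Lemma nc_le_of_sqr (z : R[i]) (e : R) : 0 <= e -> nc z ^+ 2 <= e ^+ 2 -> nc z <= e.
Proof. by move=> e0; rewrite ler_pXn2r ?nnegrE ?nc_ge0. Qed.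

(** By Cauchy-Schwarz, L^2 approximation of f by a continuous p becomes uniform approximation of
    [f ** g] by [p ** g]. *)
Lemma ucont_conv f g : L2 m f -> L2 m g -> ucont (f ** g).
Proof.
move=> Lf Lg; apply: ucont_approx => e e0.
have g1 : 0 < N2 m g + 1 by rewrite ltr_wpDl// N2_ge0.
have [_ Df] := L2_ucont_dense G_hausdorff G_compact m_haar Lf.
have [p up fp] := Df (e ^+ 2 / (N2 m g + 1)) (divr_gt0 (exprn_gt0 2 e0) g1).
have Lp := ucont_L2 m G_compact up.
exists (p ** g); first by apply: ucont_conv1 => //; exact: L2_cintegrable.
move=> t; have := nc_conv_le t (L2B Lf Lp) Lg; rewrite convBl// => h.
apply: nc_le_of_sqr; first exact: ltW.
rewrite (le_trans h)//; move: fp; rewrite ltr_pdivlMr// => fp.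
rewrite (le_trans _ (ltW fp))// ler_wpM2l ?N2_ge0// lerDl ler01//.
Qed.

Lemma L2_conv f g : L2 m f -> L2 m g -> L2 m (f ** g).
Proof. by move=> Lf Lg; apply: ucont_L2 => //; exact: ucont_conv. Qed.

Lemma N2_conv_le f g : L2 m f -> L2 m g -> N2 m (f ** g) <= N2 m f * N2 m g.
Proof.
move=> Lf Lg; rewrite -[leRHS]sqr_sqrtr ?mulr_ge0 ?N2_ge0//.
apply: N2_bounded; first by apply: ucont_cmeasurable; exact: ucont_conv.
move=> t; apply: nc_le_of_sqr; first exact: sqrtr_ge0.
by rewrite [leRHS]sqr_sqrtr ?mulr_ge0 ?N2_ge0// nc_conv_le.
Qed.

(** At a point t this is [convolution_adjoint] with kernel g for the two functions f (t - s) and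
    k. *)
Let convA_ucont f g k : L2 m f -> ucont g -> L2 m k ->
  (f ** g) ** k = f ** (g ** k).
Proof.
move=> Lf ug Lk; have Lg := ucont_L2 m G_compact ug.
apply/funext => t.
have Lft := L2_reflect t Lf.
have := convolution_adjoint G_compact (L2_cintegrable Lft) (L2_cintegrable Lk) ug.
have -> : cintegral m (fun u => (g ** k) u * f (t - u)) = (f ** (g ** k)) t.
  by rewrite /convolution; congr cintegral; apply/funext => u; rewrite mulrC.
move=> <-; rewrite {1}/convolution; congr cintegral; apply/funext => s.
congr (_ * _); rewrite convC// /convolution -(@cintegral_reflect t).
  congr cintegral; apply/funext => u; congr (g _ * _).
  by rewrite !opprB addrC addrA subrK.
exact: cintegrable_conv.
Qed.

Lemma convA f g k : L2 m f -> L2 m g -> L2 m k ->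
  (f ** g) ** k = f ** (g ** k).
Proof.
move=> Lf Lg Lk; apply/funext => t.
have [_ Dg] := L2_ucont_dense G_hausdorff G_compact m_haar Lg.
set a := (X in X = _); set b := (X in _ = X).
suff : nc (a - b) ^+ 2 <= 0.
  rewrite -[X in _ <= X](expr0n _ 2); move/nc_le_of_sqr => /(_ (lexx 0)).
  by rewrite le_eqVlt ltNge nc_ge0 orbF nc_eq0 subr_eq0 => /eqP.
apply/ler_addgt0Pr => e e0; rewrite add0r.
have C0 : 0 <= 4 * (N2 m f * N2 m k) by rewrite !mulr_ge0 ?N2_ge0.
have C1 : 0 < 4 * (N2 m f * N2 m k) + 1 by rewrite ltr_wpDl.
have [p up gp] := Dg _ (divr_gt0 e0 C1).
have Lp := ucont_L2 m G_compact up; have Lgp := L2B Lg Lp.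
(* The associator is linear in the middle factor and vanishes at the continuous [p], so only g - p,
   small in L^2, contributes. *)
have -> : a - b = ((f ** (fun t => g t - p t)) ** k) t -
                  (f ** ((fun t => g t - p t) ** k)) t.
  rewrite [in X in _ = _ - X]convBl// !convBr//; [|exact: L2_conv..].
  rewrite convBl//; [|exact: L2_conv..].
  by rewrite /a /b -(convA_ucont Lf up Lk) opprB addrA subrK.
have h1 := nc_conv_le t (L2_conv Lf Lgp) Lk.
have h2 := nc_conv_le t Lf (L2_conv Lgp Lk).
have h3 := ler_wpM2r (N2_ge0 m k) (N2_conv_le Lf Lgp).
have h4 := ler_wpM2l (N2_ge0 m f) (N2_conv_le Lgp Lk).
have := sqr_ncD_le (((f ** (fun t => g t - p t)) ** k) t)
  (- (f ** ((fun t => g t - p t) ** k)) t).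
rewrite normcN => /le_trans; apply.
move: gp; rewrite ltr_pdivlMr// => gp.
rewrite (le_trans (lerD (ler_wpM2l (ler0n _ 2) (le_trans h1 h3))
  (ler_wpM2l (ler0n _ 2) (le_trans h2 h4))))//.
have := N2_ge0 m (fun t => g t - p t); clear -gp; move: gp.
move: (N2 m (fun t => g t - p t)) (N2 m f) (N2 m k) => x y z; lra.
Qed.

(** The involution of the convolution algebra: convolution by [star f] is the Hilbert space adjoint
    of convolution by f. *)
Definition star f := fun t => (f (- t))^*.

Lemma L2_star f : L2 m f -> L2 m (star f).
Proof.
move=> Lf; apply: L2_conj; have := L2_reflect 0 Lf.
by under eq_fun do rewrite sub0r.
Qed.

Lemma starK f : star (star f) = f.
Proof. by apply/funext => t; rewrite /star opprK conjCK. Qed.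

Lemma conv_star f g : L2 m f -> L2 m g -> star (f ** g) = star f ** star g.
Proof.
move=> Lf Lg; apply/funext => t; rewrite /star /convolution.
rewrite -cintegral_conj; last exact: cintegrable_conv.
rewrite -(@cintegral_reflect 0).
  by congr cintegral; apply/funext => s; rewrite rmorphM /= sub0r opprB opprK addrC.
apply: cintegrable_conj; exact: cintegrable_conv.
Qed.

(** Inner products become point values of convolutions, which reduces norm computations for
    convolution powers to adding exponents. *)
Lemma conv_star0 f g : L2 m f -> L2 m g ->
  (f ** star g) 0 = cintegral m (fun t => f t * (g t)^*).
Proof.
move=> Lf Lg; rewrite /convolution -(@cintegral_reflect 0).
  by congr cintegral; apply/funext => s; rewrite /star !sub0r opprK.
exact: cintegrable_conv Lf (L2_star Lg).
Qed.

Lemma N2_conv_star f : L2 m f -> (f ** star f) 0 = (N2 m f)%:C.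
Proof. by move=> Lf; rewrite conv_star0// N2E. Qed.

Lemma conv_shift (a : G) f g :
  (fun t => f (a + t)) ** g = (fun t => (f ** g) (a + t)).
Proof. by apply/funext => t; rewrite /convolution; under eq_fun do rewrite addrA. Qed.

End ConvolutionL2.

(** * Characters: orthogonality, convolution eigenvalues, Bessel's inequality *)

Section Characters.
Context {R : realType} {G : topologicalZmodType} (m : probability (borel G) R).
Implicit Types f g chi psi : G -> R[i].

Hypothesis G_hausdorff : hausdorff_space G.
Hypothesis G_compact : compact [set: G].
Hypothesis m_haar : is_haar m.

Local Notation "f ** g" := (convolution m f g) (at level 40, left associativity).
Local Notation hat := (fourier m).

Lemma char0 chi : chargroup chi -> chi 0 = 1.
Proof.
move=> [_ chiD chi1]; have := chiD 0 0; rewrite addr0 -{1}[chi 0]mulr1.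
by move/mulfI => <-//; rewrite -nc_eq0 chi1 oner_eq0.
Qed.

Lemma char_mul_conj chi t : chargroup chi -> chi t * (chi t)^* = 1.
Proof. by move=> [_ _ chi1]; rewrite mul_conjc chi1 expr1n. Qed.

Lemma charN chi t : chargroup chi -> chi (- t) = (chi t)^*.
Proof.
move=> cchi; have [_ chiD chi1] := cchi.
have chi0 : chi t != 0 by rewrite -nc_eq0 chi1 oner_eq0.
by apply: (mulfI chi0); rewrite -chiD subrr char0// char_mul_conj.
Qed.

Lemma char_ucont chi : chargroup chi -> ucont chi.
Proof.
move=> cchi; have [cont chiD chi1] := cchi; move=> e e0.
have := cont 0; move/cvgrPdist_lt => /(_ e%:C).
rewrite ltcR => /(_ e0) H.
exists [set u | nc (chi u - 1) < e].
  apply: filterS H => u /=; rewrite char0// distrC.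
  by rewrite -(ltcR (nc _)); congr (_ < _).
move=> s u /= h; rewrite chiD -{2}[chi s]mulr1 -mulrBr Normc.normcM chi1.
by rewrite mul1r.
Qed.

Lemma char_L2 chi : chargroup chi -> L2 m chi.
Proof. by move=> c; apply: ucont_L2 => //; exact: char_ucont. Qed.

Lemma N2_char chi : chargroup chi -> N2 m chi = 1.
Proof.
move=> [_ _ chi1]; rewrite /N2 -[RHS](@Rintegral1 _ _ m 1).
by congr Rintegral; apply/funext => t; rewrite chi1 expr1n.
Qed.

Lemma cintegrable_hat f chi : L2 m f -> chargroup chi ->
  cintegrable m (fun t => f t * (chi t)^*).
Proof. by move=> Lf c; apply: L2_mul => //; apply: L2_conj; exact: char_L2. Qed.

Lemma hatD f g chi : L2 m f -> L2 m g -> chargroup chi ->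
  hat (fun t => f t + g t) chi = hat f chi + hat g chi.
Proof.
move=> Lf Lg c; rewrite /fourier -cintegralD; [|exact: cintegrable_hat..].
by congr cintegral; apply/funext => t; rewrite mulrDl.
Qed.

Lemma hatZ (z : R[i]) f chi : L2 m f -> chargroup chi ->
  hat (fun t => z * f t) chi = z * hat f chi.
Proof.
move=> Lf c; rewrite /fourier -cintegralZ; last exact: cintegrable_hat.
by congr cintegral; apply/funext => t; rewrite mulrA.
Qed.

Lemma hatB f g chi : L2 m f -> L2 m g -> chargroup chi ->
  hat (fun t => f t - g t) chi = hat f chi - hat g chi.
Proof.
move=> Lf Lg c; rewrite /fourier -cintegralB; [|exact: cintegrable_hat..].
by congr cintegral; apply/funext => t; rewrite mulrBl.
Qed.

Lemma hat_le f chi : L2 m f -> chargroup chi -> nc (hat f chi) ^+ 2 <= N2 m f.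
Proof.
move=> Lf c; have := cauchy_schwarz Lf (L2_conj (char_L2 c)).
by rewrite (N2_conj m chi) (N2_char c) mulr1.
Qed.

Lemma conv_char f chi : L2 m f -> chargroup chi ->
  f ** chi = (fun t => hat f chi * chi t).
Proof.
move=> Lf c; have Lc := char_L2 c; apply/funext => t.
rewrite convC// /convolution /fourier mulrC -cintegralZ; last exact: cintegrable_hat.
congr cintegral; apply/funext => s; have [_ chiD _] := c.
by rewrite chiD charN// mulrAC -mulrA.
Qed.

(** Characters are eigenfunctions of convolution with the Fourier coefficient as eigenvalue, so
    multiplicativity is associativity of [f ** g ** chi] read at 0. *)
Lemma hat_conv f g chi : L2 m f -> L2 m g -> chargroup chi ->
  hat (f ** g) chi = hat f chi * hat g chi.
Proof.
move=> Lf Lg c; have Lc := char_L2 c.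
have Lfg := L2_conv G_hausdorff G_compact m_haar Lf Lg.
have <- : ((f ** g) ** chi) 0 = hat (f ** g) chi.
  by rewrite conv_char// char0// mulr1.
by rewrite convA// (conv_char Lg)// convZr// (conv_char Lf)// char0// mulr1 mulrC.
Qed.

Lemma hat_star f chi : L2 m f -> chargroup chi ->
  hat (star f) chi = (hat f chi)^*.
Proof.
move=> Lf c; rewrite /fourier -cintegral_conj; last exact: cintegrable_hat.
rewrite -[RHS](cintegral_reflect G_hausdorff G_compact m_haar 0); last first.
  by apply: cintegrable_conj; exact: cintegrable_hat.
congr cintegral; apply/funext => t; rewrite /star sub0r rmorphM /=.
by rewrite (charN t c) conjCK.
Qed.

Lemma hat_char chi psi : chargroup chi -> chargroup psi ->
  hat chi psi = (chi == psi)%:R.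
Proof.
move=> c p; have [->|neq] := eqVneq chi psi.
  rewrite /fourier; under eq_fun do rewrite char_mul_conj//.
  by rewrite (cintegral_real m (cst 1)) Rintegral1.
have [a chia] : exists a, chi a != psi a.
  apply: contrapT => /forallNP H; move/eqP : neq; apply; apply/funext => t.
  by apply/eqP/negPn/negP => /H.
(* Translating by a point where the two characters differ multiplies the integral by a factor other
   than 1, while invariance leaves it unchanged; hence it vanishes. *)
have shift : chi a * (psi a)^* * hat chi psi = hat chi psi.
  have I := cintegrable_hat (char_L2 c) p.
  rewrite /fourier -cintegralZ//.
  rewrite -[RHS](cintegral_mp (measure_preserving_shift m_haar a))//.
  congr cintegral; apply/funext => t; have [[_ cD _] [_ pD _]] := (c, p).
  by rewrite cD pD rmorphM mulrACA.
apply/eqP/negPn/negP => h0; move/eqP : chia; apply.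
have := mulIf h0 (etrans shift (esym (mul1r _))).
move/(congr1 ( *%R^~ (psi a))).
by rewrite -mulrA mulrC (mulrC _^*) char_mul_conj// !mul1r.
Qed.

Lemma bessel f (s : seq (G -> R[i])) : L2 m f -> uniq s ->
  (forall chi, chi \in s -> chargroup chi) ->
  \sum_(chi <- s) nc (hat f chi) ^+ 2 <= N2 m f.
Proof.
move=> Lf us cs.
pose P (s : seq (G -> R[i])) t := \sum_(chi <- s) hat f chi * chi t.
(* The induction carries the coefficients of the partial sum besides the norm of the residual: they
   show that f - P s keeps the coefficient of f along a character outside s. *)
suff [LP [hP NP]] : L2 m (P s) /\
    (forall psi, chargroup psi -> hat (P s) psi = hat f psi * (psi \in s)%:R) /\
    N2 m (fun t => f t - P s t) = N2 m f - \sum_(chi <- s) nc (hat f chi) ^+ 2.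
  by rewrite -subr_ge0 -NP N2_ge0.
elim: s us cs => [_ _|chi s IH /= /andP[chis us] cs].
  rewrite /P; under [X in L2 _ X]eq_fun do rewrite big_nil.
  split; first exact: L2_cst.
  split => [psi cpsi|].
    under [X in hat X]eq_fun do rewrite big_nil.
    rewrite /fourier; under eq_fun do rewrite mul0r.
    by rewrite (cintegral_real m (cst 0)) Rintegral1 mulr0.
  by rewrite big_nil subr0; congr N2; apply/funext => t; rewrite big_nil subr0.
have cchi : chargroup chi by apply: cs; rewrite mem_head.
have [|LP [hP NP]] := IH us.
  by move=> psi ps; apply: cs; rewrite inE ps orbT.
have Lc := L2Z (hat f chi) (char_L2 cchi).
have -> : P (chi :: s) = (fun t => hat f chi * chi t + P s t).
  by apply/funext => t; rewrite /P big_cons.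
split; first exact: L2D.
split => [psi cpsi|].
  rewrite hatD// hatZ ?(hat_char cchi cpsi) ?hP//; last exact: char_L2.
  rewrite inE; have [->|neq] := eqVneq psi chi.
    by rewrite (negbTE chis) mulr0 addr0.
  by rewrite mulr0 add0r.
rewrite big_cons opprD addrCA -NP addrC.
have -> : (fun t => f t - (hat f chi * chi t + P s t)) =
    (fun t => (f t - P s t) - hat f chi * chi t).
  by apply/funext => t; rewrite opprD addrAC addrA.
have LfP := L2B Lf LP.
rewrite N2B// N2Z; last exact: char_L2.
rewrite (N2_char cchi) mulr1.
have -> : cintegral m (fun t => (f t - P s t) * (hat f chi * chi t)^*) =
    (nc (hat f chi) ^+ 2)%:C.
  transitivity ((hat f chi)^* * hat (fun t => f t - P s t) chi).
    rewrite /fourier -cintegralZ; last exact: cintegrable_hat.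
    by congr cintegral; apply/funext => t; rewrite rmorphM /= mulrCA.
  by rewrite hatB// hP// (negbTE chis) mulr0 subr0 mulrC mul_conjc.
set q := nc (hat f chi) ^+ 2; rewrite (_ : complex.Re q%:C = q)//. 
by move: (N2 m (fun t => f t - P s t)) => x; ring.
Qed.

End Characters.

(** * Powers of a hermitian kernel *)

Section UniformLimit.
Context {R : realType} {T : Type}.
Implicit Types (E : nat -> T -> R[i]) (l : T -> R[i]).

Definition unif_cvg E l := forall e : R, 0 < e ->
  exists N, forall n, (N <= n)%N -> forall t, nc (E n t - l t) <= e.

Lemma real_cauchy_cvg (u : nat -> R) :
  (forall e : R, 0 < e -> exists N, forall i, (N <= i)%N -> `|u N - u i| < e) ->
  cvgn u.
Proof.
move=> H; apply: cauchy_cvg; apply: cauchy_exP => e e0.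
by have [N HN] := H e e0; exists (u N); exists N.
Qed.

Lemma unif_cauchy_cvg E :
  (forall e : R, 0 < e -> exists N, forall i j, (N <= i)%N -> (N <= j)%N ->
    forall t, nc (E i t - E j t) <= e) ->
  exists l, unif_cvg E l.
Proof.
move=> H; exists (fun t => limn (fun n => complex.Re (E n t)) +i*
                           limn (fun n => complex.Im (E n t))) => e e0.
have cR t : cvgn (fun n => complex.Re (E n t)).
  apply: real_cauchy_cvg => e1 e10; have [N HN] := H (e1 / 2) (divr_gt0 e10 (ltr0Sn _ 1)).
  exists N => i Ni; have := HN N i (leqnn N) Ni t.
  have := nc_Re (E N t - E i t); rewrite ReD; case: (E i t) => a b /=; lra.
have cI t : cvgn (fun n => complex.Im (E n t)).
  apply: real_cauchy_cvg => e1 e10; have [N HN] := H (e1 / 2) (divr_gt0 e10 (ltr0Sn _ 1)).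
  exists N => i Ni; have := HN N i (leqnn N) Ni t.
  have := nc_Im (E N t - E i t); rewrite ImD; case: (E i t) => a b /=; lra.
have e20 : 0 < e / 2 by rewrite divr_gt0.
have e40 : 0 < e / 4 by rewrite divr_gt0.
have [N HN] := H _ e20; exists N => n Nn t.
move: (cR t) (cI t) => /cvgrPdist_lt/(_ _ e40)[M1 _ H1].
move=> /cvgrPdist_lt/(_ _ e40)[M2 _ H2].
pose M := maxn N (maxn M1 M2).
have h := HN n M Nn (leq_maxl _ _) t.
have := H1 M; rewrite /= -{1}/M => /(_ (leq_trans (leq_maxl _ _) (leq_maxr _ _))).
have := H2 M; rewrite /= -{1}/M => /(_ (leq_trans (leq_maxr _ _) (leq_maxr _ _))).
move: h; set z := _ +i* _; move=> h h2 h1.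
rewrite -(subrK (E M t) (E n t)) -addrA (le_trans (le_ncD _ _))//.
have h3 := nc_le_ReIm (E M t - z).
have : `|complex.Re (E M t - z)| < e / 4 by rewrite distrC in h1; rewrite ReD.
have : `|complex.Im (E M t - z)| < e / 4 by rewrite distrC in h2; rewrite ImD.
by move: h h3; lra.
Qed.

Lemma unif_cvg_unique E l l' : unif_cvg E l -> unif_cvg E l' -> l = l'.
Proof.
move=> H H'; apply/funext => t; apply/eqP; rewrite -subr_eq0 -nc_eq0.
rewrite eq_le nc_ge0 andbT; apply/ler_addgt0Pr => e e0; rewrite add0r.
have e20 : 0 < e / 2 by rewrite divr_gt0.
have [[N HN] [M HM]] := (H _ e20, H' _ e20).
have h := HN (maxn N M) (leq_maxl _ _) t.
have h' := HM (maxn N M) (leq_maxr _ _) t.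
rewrite nc_distC in h; rewrite -(subrK (E (maxn N M) t) (l t)) -addrA.
by rewrite (le_trans (le_ncD _ _))// (splitr e) lerD.
Qed.

Lemma unif_cvg_shift E l (k : nat) : unif_cvg E l -> unif_cvg (fun n => E (n + k)%N) l.
Proof.
by move=> H e /H[N HN]; exists N => n Nn; apply: HN; rewrite (leq_trans Nn)// leq_addr.
Qed.

Lemma unif_cvgZ E l (c : R[i]) : unif_cvg E l ->
  unif_cvg (fun n t => c * E n t) (fun t => c * l t).
Proof.
move=> H e e0; have c1 : 0 < nc c + 1 by rewrite ltr_wpDl// nc_ge0.
have [N HN] := H _ (divr_gt0 e0 c1); exists N => n Nn t.
rewrite -mulrBr Normc.normcM; have := HN n Nn t; rewrite ler_pdivlMr// mulrC => h.
by rewrite (le_trans _ h)// ler_wpM2r ?nc_ge0// lerDl.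
Qed.

End UniformLimit.

Lemma unif_cvg_ucont {R : realType} {G : topologicalZmodType}
  (E : nat -> G -> R[i]) (l : G -> R[i]) :
  (forall n, ucont (E n)) -> unif_cvg E l -> ucont l.
Proof.
move=> uE El; apply: ucont_approx => e e0; have [N HN] := El _ e0.
by exists (E N) => // t; rewrite nc_distC HN.
Qed.

(** To be applied with c n = N2 (k^(n+1)), whence the exponent [n.+1]. The ratios r increase by
    log-convexity and are bounded by c 0; L is their limit. In (r i)^(n+1) * c i <= c (i+n+1) <= c i
    * c n one cancels c i and lets i grow, so that c n >= L^(n+1); and r n <= L makes the normalised
    sequence decrease. *)
Lemma logconvex_submul_rate {R : realType} (c : nat -> R) :
  (forall n, 0 < c n) -> (forall n, c n.+1 ^+ 2 <= c n * c n.+2) ->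
  (forall i j, c (i + j).+1 <= c i * c j) ->
  exists2 L, 0 < L & [/\ nonincreasing_seq (fun n => c n / L ^+ n.+1),
    forall n, 1 <= c n / L ^+ n.+1 & exists l, forall e, 0 < e ->
    exists N, forall n, l <= c n / L ^+ n.+1 /\ c N / L ^+ N.+1 < l + e].
Proof.
move=> c_gt0 c_logconvex c_submul; pose r n := c n.+1 / c n.
have r_gt0 n : 0 < r n by exact: divr_gt0.
have r_ndecr : nondecreasing_seq r.
  apply/nondecreasing_seqP => n; rewrite /r ler_pdivrMr// mulrAC ler_pdivlMr//.
  by rewrite -expr2 mulrC.
have r_cvg : cvgn r.
  apply: (nondecreasing_is_cvgn r_ndecr); exists (c 0) => _ [n _ <-].
  by rewrite /r ler_pdivrMr//; exact: (c_submul 0 n).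
pose L := limn r; have r_le := nondecreasing_cvgn_le r_ndecr r_cvg.
have L_gt0 : 0 < L by exact: lt_le_trans (r_gt0 0) (r_le 0).
have Ln j : 0 < L ^+ j by exact: exprn_gt0.
have c_growth i j : r i ^+ j * c i <= c (i + j)%N.
  elim: j => [|j IH]; first by rewrite expr0 mul1r addn0.
  have -> : c (i + j.+1)%N = r (i + j)%N * c (i + j)%N.
    by rewrite /r divfK ?gt_eqF// addnS.
  rewrite exprS -mulrA; apply: ler_pM => //.
  - by rewrite ltW.
  - by rewrite mulr_ge0 ?exprn_ge0// ltW.
  - by apply: r_ndecr; rewrite leq_addr.
have rn n i : r i ^+ n.+1 <= c n.
  have := le_trans (c_growth i n.+1) _; rewrite addnS => /(_ _ (c_submul i n)).
  by rewrite mulrC ler_pM2l.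
have c_lower n : L ^+ n.+1 <= c n.
  have H : (fun i => r i ^+ n.+1) @ \oo --> L ^+ n.+1.
    apply: (@continuous_cvg _ _ _ _ _ _ (fun x : R => x ^+ n.+1)) => //.
    exact: exprn_continuous.
  rewrite -(cvg_lim (@Rhausdorff R) H); apply: limr_le.
    by apply/cvg_ex; exists (L ^+ n.+1).
  exact: nearW.
have d_nincr : nonincreasing_seq (fun n => c n / L ^+ n.+1).
  apply/nonincreasing_seqP => n.
  rewrite ler_pdivrMr// mulrAC ler_pdivlMr// [in leRHS]exprS mulrA ler_pM2r//.
  by have := r_le n; rewrite {1}/r ler_pdivrMr// mulrC.
have d_ge1 n : 1 <= c n / L ^+ n.+1 by rewrite ler_pdivlMr// mul1r.
exists L => //; split => //.
have d_cvg : cvgn (fun n => c n / L ^+ n.+1).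
  by apply: (nonincreasing_is_cvgn d_nincr); exists 1 => _ [n _ <-]; exact: d_ge1.
exists (limn (fun n => c n / L ^+ n.+1)) => e e0.
have := d_cvg; move=> /cvgrPdist_lt/(_ _ e0)[N _ /(_ N (leqnn N))] /= HN.
exists N => n; split; first exact: nonincreasing_cvgn_ge.
by rewrite -ltrBlDl; apply: le_lt_trans HN; rewrite distrC ler_norm.
Qed.

(** * The top spectral projection of convolution by a hermitian kernel *)

Section PowerIteration.
Context {R : realType} {G : topologicalZmodType} (m : probability (borel G) R).
Implicit Types e f g : G -> R[i].

Hypothesis G_hausdorff : hausdorff_space G.
Hypothesis G_compact : compact [set: G].
Hypothesis m_haar : is_haar m.

Local Notation "f ** g" := (convolution m f g) (at level 40, left associativity).

Lemma unif_cvg_conv (E : nat -> G -> R[i]) l g : (forall n, ucont (E n)) ->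
  unif_cvg E l -> L2 m g -> unif_cvg (fun n => E n ** g) (l ** g).
Proof.
move=> uE El Lg e e0; have g1 : 0 < N2 m g + 1 by rewrite ltr_wpDl// N2_ge0.
have sg : 0 < Num.sqrt (N2 m g + 1) by rewrite sqrtr_gt0.
have [N HN] := El _ (divr_gt0 e0 sg); exists N => n Nn t.
have LE := ucont_L2 m G_compact (uE n).
have ul := unif_cvg_ucont uE El.
have Ll := ucont_L2 m G_compact ul.
have -> : (E n ** g) t - (l ** g) t = ((fun t => E n t - l t) ** g) t.
  by rewrite convBl.
apply: nc_le_of_sqr; first exact: ltW.
have LB := L2B LE Ll.
rewrite (le_trans (nc_conv_le G_hausdorff G_compact m_haar t LB Lg))//.
have := @N2_bounded _ _ m _ _ (proj1 LB) (HN n Nn).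
rewrite expr_div_n sqr_sqrtr; last exact: ltW.
rewrite ler_pdivlMr// => h; rewrite (le_trans _ h)// ler_wpM2l ?N2_ge0//.
by rewrite lerDl.
Qed.

Lemma mrealU_le (A B : set (borel G)) : measurable A -> measurable B ->
  mreal m (A `|` B) <= mreal m A + mreal m B.
Proof.
move=> mA mB; rewrite -lee_fin EFinD !mrealE//; last exact: measurableU.
exact: measureU2.
Qed.

Lemma open_shift (U : set G) a : open U -> open [set t | U (t - a)].
Proof.
have /continuousP := @continuousDl G (- a); move=> h /h; congr open.
by apply/seteqP; split => t /=; rewrite addrC.
Qed.

(** Finitely many translates of U cover G and all have the same measure, so a null U would force m G
    = 0. *)
Lemma haar_open_gt0 (U : set G) (a : G) : open U -> nbhs (0 : G) U ->
  0 < mreal m [set t | U (t - a)].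
Proof.
move=> oU nU; have mU := open_borel oU.
have shiftE b : mreal m [set t | U (t - b)] = mreal m U.
  rewrite /mreal -((measure_preserving_shift m_haar (- b)).2 U mU).
  congr (fine (m _)); apply/seteqP; split => t /=; rewrite addrC//.
rewrite shiftE; have [cs cov] := translates_cover G_compact nU.
have : mreal m (\big[setU/set0]_(b <- cs) [set t | U (t - b)] : set (borel G)) <=
    (size cs)%:R * mreal m U.
  elim: cs {cov} => [|b cs IH].
    by rewrite big_nil mul0r /mreal measure0.
  have mb c : measurable ([set t | U (t - c)] : set (borel G)).
    by apply: open_borel; exact: open_shift.
  rewrite big_cons (le_trans (mrealU_le _ _))//.
    by apply: bigsetU_measurable => c _; exact: mb.
  by rewrite shiftE [size _]/= -nat1r mulrDl mul1r lerD2l.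
have -> : \big[setU/set0]_(b <- cs) [set t | U (t - b)] = setT.
  apply/seteqP; split => // t _; have [b bcs Ub] := cov t.
  by rewrite -bigcup_seq; exists b.
have -> : mreal m setT = 1 by rewrite /mreal (@probability_setT _ _ _ m).
move=> h; rewrite lt_def /mreal fine_ge0 ?andbT//.
by apply/eqP => U0; move: h; rewrite /mreal U0 mulr0 ler10.
Qed.

Lemma ucont_N2_eq0 f : ucont f -> N2 m f = 0 -> forall t, f t = 0.
Proof.
move=> uf f0 a; apply/eqP; rewrite -nc_eq0; apply/negPn/negP => fa.
have fa0 : 0 < nc (f a) by rewrite lt_def fa nc_ge0.
have fa20 : 0 < nc (f a) / 2 by rewrite divr_gt0.
have [U nU fU] := uf _ fa20.
have oU := @open_interior _ U; have nU' := nbhs_interior nU.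
have V0 := haar_open_gt0 a oU nU'.
have mV := open_borel (open_shift a oU).
suff : (nc (f a) / 2) ^+ 2 * mreal m [set t | U° (t - a)] <= N2 m f.
  by rewrite f0 leNgt mulr_gt0// exprn_gt0.
rewrite -Rintegral_mreal// -RintegralZl//; last exact: integ_indic.
have [_ If] := ucont_L2 m G_compact uf.
apply: Rintegral_le => //; first by apply: integZ; exact: integ_indic.
move=> t; rewrite ?indicE; have [/set_mem Vt|_] := boolP (_ \in _); last first.
  by rewrite mulr0 sqr_ge0.
have := fU a _ (interior_subset Vt); rewrite subrKC => h.
rewrite mulr1 lerXn2r// ?nnegrE ?nc_ge0 ?ltW//.
by have := le_ncB (f a) (f t); rewrite nc_distC; lra.
Qed.

(** Off by one: [convpow k n] is the power k^(n+1), as there is in general no unit to start from. *)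
Definition convpow k n := iter n (convolution m k) k.

Lemma convpowS k n : convpow k n.+1 = k ** convpow k n. Proof. by []. Qed.

Arguments convpow : simpl never.

Lemma ucont_convpow k n : ucont k -> ucont (convpow k n).
Proof.
move=> uk; elim: n => // n IH; rewrite convpowS.
by apply: ucont_conv => //; exact: ucont_L2.
Qed.

Lemma convpow_add k i j : ucont k ->
  convpow k i ** convpow k j = convpow k (i + j).+1.
Proof.
move=> uk; have L n : L2 m (convpow k n) by apply: ucont_L2; [|exact: ucont_convpow].
have Lk := ucont_L2 m G_compact uk.
elim: i => [|i IH]; first by rewrite add0n convpowS.
by rewrite addSn convpowS [RHS]convpowS -IH (convA _ _ m_haar).
Qed.

Lemma star_convpow k n : ucont k -> star k = k -> star (convpow k n) = convpow k n.
Proof.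
move=> uk sk; have L i : L2 m (convpow k i) by apply: ucont_L2; [|exact: ucont_convpow].
have Lk := ucont_L2 m G_compact uk.
by elim: n => // n IH; rewrite convpowS (conv_star _ _ m_haar)// IH sk.
Qed.

Lemma convpow_at0 k i j : ucont k -> star k = k -> convpow k (i + j).+1 0 =
  cintegral m (fun t => convpow k i t * (convpow k j t)^*).
Proof.
move=> uk sk; have L n : L2 m (convpow k n) by apply: ucont_L2; [|exact: ucont_convpow].
by rewrite -(conv_star0 G_hausdorff G_compact m_haar)// star_convpow// convpow_add.
Qed.

Lemma convpow_at0_N2 k i : ucont k -> star k = k ->
  convpow k (i + i).+1 0 = (N2 m (convpow k i))%:C.
Proof. by move=> uk sk; rewrite convpow_at0// N2E. Qed.

Lemma N2_convpow_gt0 k n : ucont k -> star k = k -> 0 < N2 m k ->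
  0 < N2 m (convpow k n).
Proof.
move=> uk sk k0; elim: n => [//|n IH]; rewrite lt_def N2_ge0 andbT.
apply/eqP => c0; have Pn := ucont_N2_eq0 (ucont_convpow n.+1 uk) c0.
(* If k^(n+2) vanishes, so do all later powers, in particular k^(2n+2), whose value at 0 is N2 of
   k^(n+1). *)
have P0 j t : convpow k (n.+1 + j)%N t = 0.
  elim: j t => [|j IHj] t; first by rewrite addn0.
  rewrite addnS convpowS /convolution; under eq_fun do rewrite IHj mulr0.
  by rewrite (cintegral_real m (cst 0)) Rintegral1.
have := P0 n 0; rewrite addSn convpow_at0_N2// => /complexI cn0.
by rewrite cn0 ltxx in IH.
Qed.

(* The ratios [N2 (k^(n+1)) / N2 (k^n)] increase to the square [l] of the spectral
   radius of convolution by [k], and the normalised even powers of [k] converge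
   uniformly to the kernel of the corresponding spectral projection. *)
Lemma power_iteration k : ucont k -> star k = k -> 0 < N2 m k ->
  exists (l : R) e,
  [/\ 0 < l, ucont e, star e = e, e ** e = e & N2 m e != 0] /\
  (k ** k) ** e = (fun t => l%:C * e t) /\
  (forall e0, ucont e0 -> k ** e0 = k -> e ** e0 = e).
Proof.
move=> uk sk k0; pose c n := N2 m (convpow k n).
have uP n : ucont (convpow k n) by exact: ucont_convpow.
have LP n : L2 m (convpow k n) by apply: ucont_L2; [|exact: uP].
have Lk : L2 m k := LP 0.
(* Cauchy-Schwarz for the convolution of k^(n+1) and k^(n+3), whose value at 0 is [c n.+1]. *)
have c_logconvex n : c n.+1 ^+ 2 <= c n * c n.+2.
  have := nc_conv_le G_hausdorff G_compact m_haar 0 (LP n) (LP n.+2).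
  have -> : convpow k n ** convpow k n.+2 = convpow k (n.+1 + n.+1).+1.
    by rewrite convpow_add//; congr (convpow k _); lia.
  by rewrite (convpow_at0_N2 _ uk sk) nc_real real_normK ?num_real.
have c_submul i j : c (i + j).+1 <= c i * c j.
  rewrite /c -convpow_add//; exact: N2_conv_le.
have [l l0 [d_nincr d_ge1 [dl d_cvg]]] :=
  logconvex_submul_rate (fun n => N2_convpow_gt0 n uk sk k0) c_logconvex c_submul.
pose d n := c n / l ^+ n.+1.
(* Only the even powers k^(2n+2) are used, so that eigenvalues of opposite signs contribute alike;
   [l] is the square of the spectral radius, hence the exponent n + 1. *)
pose E n t := (l ^- n.+1)%:C * convpow k (n + n).+1 t.
have uE n : ucont (E n) by exact: ucontZ.
have LE n : L2 m (E n) by apply: ucont_L2; [|exact: uE].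
have E_star n : star (E n) = E n.
  apply/funext => t; rewrite /star /E conjcM conjcR; congr (_ * _).
  exact: (congr1 (@^~ t) (star_convpow (n + n).+1 uk sk)).
have E_conv i j : E i ** E j = E (i + j).+1.
  rewrite /E (convZl G_hausdorff _ m_haar)//; last exact: ucont_L2 (ucontZ _ (uP _)).
  rewrite (convZr G_hausdorff _ m_haar)//.
  apply/funext => t; rewrite convpow_add// mulrA -rmorphM -invfM -exprD.
  by congr ((_ ^- _)%:C * convpow k _ t); lia.
have E_at0 n : E n 0 = (d n)%:C.
  by rewrite /E convpow_at0_N2// -rmorphM mulrC.
have N2_E n : N2 m (E n) = d (n + n).+1.
  apply: (@complexI R).
  by rewrite -(N2_conv_star G_hausdorff G_compact m_haar)// E_star E_conv E_at0.
(* The inner product of [E i] and [E j] is [d (i + j).+1], so the convergence of [d] makes [E]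
   Cauchy in L^2. *)
have N2_EB i j : N2 m (fun t => E i t - E j t) =
    d (i + i).+1 - 2 * d (i + j).+1 + d (j + j).+1.
  rewrite N2B// !N2_E; congr (_ - 2 * _ + _).
  by rewrite -(conv_star0 G_hausdorff G_compact m_haar)// E_star E_conv E_at0.
(* One more convolution by [k ** k] upgrades the L^2 Cauchy property to a uniform one. *)
have E_succ n : E n.+1 = (fun t => (l^-1)%:C * (convpow k 1 ** E n) t).
  apply/funext => t; rewrite /E (convZr G_hausdorff _ m_haar)// convpow_add//.
  rewrite mulrA -rmorphM -invfM -exprS.
  by congr (_%:C * convpow k _ t); lia.
have E_cauchy (e : R) : 0 < e -> exists N, forall i j, (N <= i)%N ->
    (N <= j)%N -> forall t, nc (E i t - E j t) <= e.
  move=> e0.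
  have c1 : 0 < 2 * (l^-1 ^+ 2 * c 1).
    by rewrite !mulr_gt0 ?exprn_gt0 ?invr_gt0//; exact: N2_convpow_gt0.
  have [N HN] := d_cvg _ (divr_gt0 (exprn_gt0 2 e0) c1).
  exists N.+1 => -[//|i] [//|j]; rewrite !ltnS => Ni Nj t.
  rewrite !E_succ -mulrBr.
  have -> : (convpow k 1 ** E i) t - (convpow k 1 ** E j) t =
      (convpow k 1 ** (fun t => E i t - E j t)) t.
    by rewrite (convBr G_hausdorff _ m_haar).
  apply: nc_le_of_sqr; first exact: ltW.
  rewrite Normc.normcM exprMn nc_real real_normK ?num_real//.
  have h := nc_conv_le G_hausdorff G_compact m_haar t (LP 1) (L2B (LE i) (LE j)).
  rewrite (le_trans (ler_wpM2l (sqr_ge0 _) h))// N2_EB mulrA -/(c 1).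
  have k1 : d (i + i).+1 <= d N by apply: d_nincr; lia.
  have k2 : d (j + j).+1 <= d N by apply: d_nincr; lia.
  have [k3 hN] := HN (i + j).+1; rewrite -!/(d _) in k3 hN.
  move: hN; rewrite -ltrBlDl ltr_pdivlMr// => /ltW hN; rewrite (le_trans _ hN)//.
  have q0 : 0 <= l^-1 ^+ 2 * c 1.
    by apply: mulr_ge0; [exact: sqr_ge0|exact: N2_ge0].
  have hA : d (i + i).+1 - 2 * d (i + j).+1 + d (j + j).+1 <= 2 * (d N - dl).
    by move: k1 k2 k3; lra.
  by rewrite (le_trans (ler_wpM2l q0 hA))// [leRHS]mulrC -[leRHS]mulrA [leRHS]mulrCA.
have [e Ee] := unif_cauchy_cvg E_cauchy.
have ue := unif_cvg_ucont uE Ee.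
have Le : L2 m e by exact: ucont_L2.
have P1e : convpow k 1 ** e = (fun t => l%:C * e t).
  have h1 := unif_cvg_conv uE Ee (LP 1).
  have h2 := unif_cvgZ l%:C (unif_cvg_shift 1 Ee).
  rewrite (convC G_hausdorff _ m_haar)//; apply: (unif_cvg_unique h1).
  rewrite (_ : (fun n => E n ** convpow k 1) = (fun n t => l%:C * E (n + 1)%N t))//.
  apply/funext => n; apply/funext => t.
  rewrite addn1 E_succ mulrA -rmorphM mulfV ?gt_eqF// rmorph1 mul1r.
  by rewrite (convC G_hausdorff _ m_haar).
have e_star : star e = e.
  apply: (@unif_cvg_unique _ _ E) => // e1 /Ee[N HN].
  exists N => n Nn t; have := HN n Nn (- t).
  by rewrite -[E n t](congr1 (@^~ t) (E_star n)) /star -conjcB nc_conj.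
have Ene n : E n ** e = e.
  elim: n => [|n IH]; last first.
    rewrite E_succ (convZl G_hausdorff _ m_haar)//; last exact: L2_conv.
    rewrite (convA _ _ m_haar)// IH P1e; apply/funext => t.
    by rewrite mulrA -rmorphM mulVf ?gt_eqF// rmorph1 mul1r.
  rewrite /E (convZl G_hausdorff _ m_haar)// P1e; apply/funext => t.
  by rewrite expr1 mulrA -rmorphM mulVf ?gt_eqF// rmorph1 mul1r.
have ee : e ** e = e.
  apply: (unif_cvg_unique (unif_cvg_conv uE Ee Le)).
  move=> e1 e10; exists 0%N => n _ t; rewrite Ene subrr Normc.normc0.
  exact: ltW.
exists l, e; split; first split => //.
  (* The limit is not 0 because E n 0 = d n >= 1. *)
  apply/eqP => Ne; have e0 := ucont_N2_eq0 ue Ne 0.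
  have h2 : 0 < 2^-1 :> R by rewrite invr_gt0.
  have [N HN] := Ee _ h2; have := HN N (leqnn N) 0.
  rewrite e0 subr0 E_at0 nc_real; have := d_ge1 N; have := ler_norm (d N).
  rewrite -/(d N); lra.
split => // e0 ue0 ke0; have Le0 : L2 m e0 by exact: ucont_L2.
have Pe0 n : convpow k n ** e0 = convpow k n.
  by elim: n => // n IH; rewrite convpowS (convA _ _ m_haar)// IH.
apply: (unif_cvg_unique (unif_cvg_conv uE Ee Le0)).
rewrite (_ : (fun n => E n ** e0) = E)//; apply/funext => n.
by rewrite /E (convZl G_hausdorff _ m_haar)// Pe0.
Qed.

End PowerIteration.

(** * Minimal idempotents are characters *)

Section PeterWeyl.
Context {R : realType} {G : topologicalZmodType} (m : probability (borel G) R).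
Implicit Types e f g chi : G -> R[i].

Hypothesis G_hausdorff : hausdorff_space G.
Hypothesis G_compact : compact [set: G].
Hypothesis m_haar : is_haar m.

Local Notation "f ** g" := (convolution m f g) (at level 40, left associativity).
Local Notation hat := (fourier m).

(** Convolution by such an e is a nonzero orthogonal projection commuting with translations; the
    relation [e' ** e = e'] used below says that the range of e' lies in that of e. *)
Definition idem e := [/\ ucont e, star e = e, e ** e = e & N2 m e != 0].

Definition minimal_idem e := idem e /\
  forall e', idem e' -> e' ** e = e' -> e' = e.

Lemma idem_L2 e : idem e -> L2 m e.
Proof. by move=> [ue _ _ _]; exact: ucont_L2. Qed.

Lemma idem_at0 e : idem e -> e 0 = (N2 m e)%:C.
Proof.
move=> ie; have Le := idem_L2 ie; have [ue se ee _] := ie.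
by rewrite -(N2_conv_star G_hausdorff G_compact m_haar)// se ee.
Qed.

(* [N2 m e] is the dimension of the space of functions fixed by [e]. *)
Lemma idem_N2_ge1 e : idem e -> 1 <= N2 m e.
Proof.
move=> ie; have Le := idem_L2 ie; have [ue se ee e0] := ie.
have N0 := N2_ge0 m e; have Npos : 0 < N2 m e by rewrite lt_def e0.
have : N2 m e <= N2 m e ^+ 2.
  apply: N2_bounded; first exact: ucont_cmeasurable.
  move=> t; apply: nc_le_of_sqr => //.
  by have := nc_conv_le G_hausdorff G_compact m_haar t Le Le; rewrite ee -expr2.
by rewrite expr2 -{1}[N2 m e]mulr1 ler_pM2l.
Qed.

(** Additivity of [N2] comes from N2 e = e 0, which is linear in e. *)
Lemma idemB e e' : idem e -> idem e' -> e' ** e = e' -> e' <> e ->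
  idem (fun t => e t - e' t) /\ N2 m (fun t => e t - e' t) = N2 m e - N2 m e'.
Proof.
move=> ie ie' e'e ne; have [Le Le'] := (idem_L2 ie, idem_L2 ie').
have [[ue se ee _] [ue' se' ee' _]] := (ie, ie').
have uB : ucont (fun t => e t - e' t).
  have := ucontD ue (ucontZ (-1) ue').
  by under [X in ucont X -> _]eq_fun do rewrite mulN1r.
have iB : idem (fun t => e t - e' t).
  split => //.
  - apply/funext => t; rewrite -{2}se -{2}se' /star; exact: conjcB.
  - rewrite (convBl G_hausdorff _ m_haar)//; last exact: L2B.
    rewrite !(convBr G_hausdorff _ m_haar)// ee ee' e'e.
    rewrite (convC G_hausdorff _ m_haar Le)// e'e.
    by apply/funext => t; rewrite subrr subr0.
  - apply/eqP => N0; apply: ne; apply/funext => t; apply/esym/eqP.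
    by rewrite -subr_eq0 (ucont_N2_eq0 G_compact m_haar uB N0).
split => //; apply: (@complexI R).
by rewrite -idem_at0// rmorphB !idem_at0.
Qed.

(** Descent: the complement e - e' of a proper sub-idempotent is again idempotent, so its [N2] is at
    least 1 and N2 e' <= N2 e - 1. *)
Lemma minimal_idem_exists e : idem e ->
  exists2 e', minimal_idem e' & e' ** e = e'.
Proof.
move=> ie; have [n] : exists n : nat, N2 m e < n%:R.
  by exists (Num.bound (N2 m e)); exact: archi_boundP (N2_ge0 _ _).
elim: n e ie => [e ie|n IH e ie Nn].
  by rewrite ltNge N2_ge0.
have [min|/existsNP[e' /not_implyP[ie' /not_implyP[e'e ne]]]] :=
    pselect (forall e', idem e' -> e' ** e = e' -> e' = e).
  by exists e => //; case: ie.
have [iB NB] := idemB ie ie' e'e ne.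
have [|e1 min e1e'] := IH e' ie'.
  by have := idem_N2_ge1 iB; rewrite NB; move: Nn; rewrite -natr1; lra.
exists e1 => //; have [L1 [L2' L3]] := (idem_L2 (proj1 min), (idem_L2 ie', idem_L2 ie)).
by rewrite -{1}e1e' (convA G_hausdorff _ m_haar)// e'e.
Qed.

Section Minimal.
Variable e : G -> R[i].
Hypothesis e_min : minimal_idem e.

Let ie : idem e. Proof. by case: e_min. Qed.
Let ue : ucont e. Proof. by case: ie. Qed.
Let se : star e = e. Proof. by case: ie. Qed.
Let ee : e ** e = e. Proof. by case: ie. Qed.
Let Le : L2 m e. Proof. exact: idem_L2. Qed.

(** Power iteration on f yields an idempotent below e, hence e itself by minimality. Thus [f ** f]
    acts on e as a scalar, while e fixes [f ** f]. *)
Lemma minimal_square f : ucont f -> star f = f -> f ** e = f ->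
  exists l : R[i], f ** f = (fun t => l * e t).
Proof.
move=> uf sf fe; have Lf := ucont_L2 m G_compact uf.
have [N0|N0] := eqVneq (N2 m f) 0.
  have f0 := ucont_N2_eq0 G_compact m_haar uf N0.
  exists 0; apply/funext => t; rewrite mul0r /convolution.
  under eq_fun do rewrite f0 mul0r.
  by rewrite (cintegral_real m (cst 0)) Rintegral1.
have Npos : 0 < N2 m f by rewrite lt_def N0 N2_ge0.
have [l [e' [[l0 ue' se' ee' N'] [ffe' He']]]] :=
  power_iteration G_hausdorff G_compact m_haar uf sf Npos.
have e'E : e' = e by apply: (proj2 e_min) => //; exact: He'.
exists l%:C; rewrite -e'E -ffe' e'E (convA G_hausdorff _ m_haar)// fe//.
Qed.

(** Polarisation against e: expanding the square of f + e writes 2 f as a combination of two squares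
    and e, all of them multiples of e. *)
Lemma minimal_hermitian f : ucont f -> star f = f -> f ** e = f ->
  exists l : R[i], f = (fun t => l * e t).
Proof.
move=> uf sf fe; have Lf := ucont_L2 m G_compact uf.
have [l1 h1] := minimal_square uf sf fe.
have ufe := ucontD uf ue; have Lfe := ucont_L2 m G_compact ufe.
have [||l2 h2] := minimal_square ufe.
- apply/funext => t; rewrite -[in RHS]sf -[in RHS]se /star; exact: rmorphD.
- by rewrite (convDl G_hausdorff _ m_haar)// fe ee.
exists ((l2 - l1 - 1) / 2); apply/funext => t.
have := congr1 (@^~ t) h2.
rewrite (convDl G_hausdorff _ m_haar)// !(convDr G_hausdorff _ m_haar)//.
rewrite (convC G_hausdorff _ m_haar Le)// fe ee h1 => h.
have h' : 2 * f t = (l2 - l1 - 1) * e t.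
  by rewrite !mulrBl -h; ring.
apply: (@mulfI _ 2); first by rewrite pnatr_eq0.
by rewrite h' mulrA [2 * _]mulrC divfK ?pnatr_eq0.
Qed.

(** The involution exchanges the translates f_a and f_(-a) of e, so f_a + f_(-a) and j (f_a -
    f_(-a)), with j the imaginary unit, are hermitian. Both are fixed by e, hence multiples of e,
    and f_a is a combination of them. *)
Lemma minimal_translate a : exists l : R[i], forall t, e (a + t) = l * e t.
Proof.
have seN t : (e t)^* = e (- t) by rewrite -[in RHS]se /star opprK.
pose fa b t := e (b + t).
have ufa b : ucont (fa b) by exact: ucont_shift.
have Lfa b : L2 m (fa b) by apply: ucont_L2; [|exact: ufa].
have fae b : fa b ** e = fa b by rewrite /fa conv_shift ee.
have sfa b t : (fa b (- t))^* = fa (- b) t.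
  by rewrite /fa seN opprD opprK.
have uA : ucont (fun t => fa a t + fa (- a) t) by exact: ucontD.
have [||l1 h1] := minimal_hermitian uA.
- by apply/funext => t; rewrite /star conjcD !sfa opprK addrC.
- by rewrite (convDl G_hausdorff _ m_haar)// !fae.
pose j : R[i] := 0 +i* 1.
have jj : j * j = -1 by apply: complex_eq; rewrite /=; ring.
have cj : j^* = - j by rewrite conjcE; apply: complex_eq; rewrite /= ?oppr0.
have cNj : (- j)^* = j by rewrite rmorphN; exact: (canLR opprK cj).
have uB : ucont (fun t => j * fa a t + (- j) * fa (- a) t).
  by apply: ucontD; exact: ucontZ.
have [||l2 h2] := minimal_hermitian uB.
- by apply/funext => t; rewrite /star conjcD !conjcM !sfa cj cNj opprK addrC.
- rewrite (convDl G_hausdorff _ m_haar)//; [|exact: L2Z..].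
  by rewrite !(convZl G_hausdorff _ m_haar)// !fae.
exists ((l1 - j * l2) / 2) => t.
have k1 := congr1 (@^~ t) h1; have k2 := congr1 (@^~ t) h2.
apply: (@mulfI _ 2); first by rewrite pnatr_eq0.
have -> : 2 * ((l1 - j * l2) / 2 * e t) = l1 * e t - j * (l2 * e t).
  by rewrite [_ / 2]mulrC -!mulrA mulVKf ?pnatr_eq0// mulrBl mulrA.
rewrite -k1 -k2 mulrDr !mulrA mulrN jj opprK mulN1r mul1r /fa.
by rewrite opprD opprK addrACA subrr addr0 mulr_natl mulr2n.
Qed.

(** Proportional translates make e / e 0 multiplicative. As e is hermitian, chi (-t) is the
    conjugate of chi t, so |chi t|^2 = chi 0 = 1. *)
Lemma minimal_char : exists2 chi, chargroup chi & forall t, e t = e 0 * chi t.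
Proof.
have e0N : e 0 != 0.
  by rewrite (idem_at0 ie); have [_ _ _] := ie; apply: contra => /eqP/complexI/eqP.
pose chi t := (e 0)^-1 * e t.
have echi t : e t = e 0 * chi t by rewrite /chi mulVKf.
have chiD s t : chi (s + t) = chi s * chi t.
  have [l hl] := minimal_translate s.
  have := hl 0; rewrite addr0 => hs.
  by rewrite {1 3}/chi hl /chi hs; move: e0N; move: (e 0) (e t) => x y x0; field.
have chi0 : chi 0 = 1 by rewrite /chi mulVf.
have uchi : ucont chi by exact: ucontZ.
have e0real : (e 0)^* = e 0 by rewrite (idem_at0 ie) conjcR.
have chiN t : (chi t)^* = chi (- t).
  rewrite /chi conjcM; congr (_ * _); last by rewrite -[in RHS]se /star opprK.
  by rewrite -[in RHS]e0real; exact: fmorphV.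
exists chi => //; split => //.
- move=> a; apply/cvgrPdist_lt => eps eps0.
  have epsE : eps = (complex.Re eps)%:C.
    by have := eps0; rewrite ltcE /= => /andP[/eqP h _]; apply: complex_eq.
  have r0 : 0 < complex.Re eps by move: eps0; rewrite epsE ltcR.
  apply: filterS (ucont_near a uchi r0) => t.
  by rewrite epsE distrC; move=> h; rewrite -ltcR in h.
- move=> t; have := mul_conjc (chi t); rewrite chiN -chiD subrr chi0.
  move=> /complexI/esym/eqP; rewrite sqrf_eq1 => /orP[/eqP//|/eqP h].
  by have := nc_ge0 (chi t); rewrite h oppr_ge0 ler10.
Qed.

End Minimal.

Lemma hat_neq0 k : ucont k -> star k = k -> 0 < N2 m k ->
  exists2 chi, chargroup chi & hat k chi != 0.
Proof.
move=> uk sk k0; have Lk := ucont_L2 m G_compact uk.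
have [l [e [ie' [kke _]]]] := power_iteration G_hausdorff G_compact m_haar uk sk k0.
have [l0 ue se ee N0] := ie'; have ie : idem e by [].
have [e1 min e1e] := minimal_idem_exists ie.
have [chi cchi e1chi] := minimal_char min.
have [Le Le1] := (idem_L2 ie, idem_L2 (proj1 min)).
have Lkk := L2_conv G_hausdorff G_compact m_haar Lk Lk.
have Lc := char_L2 m G_compact cchi.
exists chi => //; apply/eqP => h0.
(* Since [e1] is a multiple of chi, this value is also (hat k chi)^2 * e1 0; with l > 0 and e1 0 <>
   0 this excludes hat k chi = 0. *)
have : ((k ** k) ** e1) 0 = l%:C * e1 0.
  rewrite -{1}e1e (convC G_hausdorff _ m_haar Le1)// -(convA G_hausdorff _ m_haar)//.
  rewrite kke (convZl G_hausdorff _ m_haar)// (convC G_hausdorff _ m_haar Le)//.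
  by rewrite e1e.
have -> : e1 = (fun t => e1 0 * chi t) by apply/funext.
rewrite (convZr G_hausdorff _ m_haar)// (conv_char G_hausdorff G_compact m_haar)//.
rewrite (hat_conv G_hausdorff G_compact m_haar)// h0 mul0r mul0r mulr0.
move=> /esym/eqP; rewrite !mulf_eq0 (idem_at0 (proj1 min)).
rewrite (char0 cchi) oner_eq0 orbF -!/(_%:C == 0).
move=> /orP[|]; first by move=> /eqP/complexI/eqP; rewrite gt_eqF.
by have [_ _ _ /eqP N1] := proj1 min; move=> /eqP/complexI.
Qed.

(** The function [f ** star f] is continuous and hermitian, its transform is |hat f|^2 and its value
    at 0 is N2 f; this reduces an arbitrary f to the kernels of [hat_neq0]. *)
Lemma fourier_inj f : L2 m f -> (forall chi, chargroup chi -> hat f chi = 0) ->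
  N2 m f = 0.
Proof.
move=> Lf hf; pose k := f ** star f.
have Ls := L2_star G_hausdorff G_compact m_haar Lf.
have uk : ucont k by exact: ucont_conv.
have sk : star k = k.
  by rewrite /k (conv_star G_hausdorff G_compact m_haar)// starK
    (convC G_hausdorff _ m_haar).
apply/eqP/negPn/negP => N0; have [|chi cchi] := hat_neq0 uk sk.
- rewrite lt_def N2_ge0 andbT; apply: contra N0 => /eqP Nk.
  have := ucont_N2_eq0 G_compact m_haar uk Nk 0.
  by rewrite /k (N2_conv_star G_hausdorff G_compact m_haar)// => /complexI ->.
- by rewrite /k (hat_conv G_hausdorff G_compact m_haar)// hf// mul0r eqxx.
Qed.

End PeterWeyl.

(** * Norm bounds in the unitization *)

Section LpBounds.
Context {R : realType} {G : topologicalZmodType} (m : probability (borel G) R).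
Variable p : R.
Hypothesis p_gt2 : 2 < p.
Implicit Types f g : G -> R[i].

Hypothesis G_hausdorff : hausdorff_space G.
Hypothesis G_compact : compact [set: G].
Hypothesis m_haar : is_haar m.

Local Notation "f ** g" := (convolution m f g) (at level 40, left associativity).

(** A real upper bound stands in for the norm: bounds add and multiply as reals, and finiteness
    comes with them. *)
Definition Lp_le f (r : R) := cmeasurable f /\ (cLnorm m p f <= r%:E)%E.

Let p_gt0 : 0 < p. Proof. by rewrite (lt_trans _ p_gt2). Qed.
Let p_neq0 : p != 0. Proof. by rewrite gt_eqF. Qed.

Lemma cLnormE f : cLnorm m p f =
  ((\int[m]_t (nc (f t) `^ p)%:E) `^ p^-1)%E.
Proof.
rewrite /cLnorm unlock; congr poweR; apply: eq_integral => t _.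
by rewrite gee0_abs ?lee_fin ?nc_ge0.
Qed.

Lemma cLnorm_ge0 f : (0 <= cLnorm m p f)%E.
Proof. by rewrite cLnormE poweR_ge0. Qed.

Lemma Lp_le_ge0 f r : Lp_le f r -> 0 <= r.
Proof. by move=> [_ fr]; rewrite -lee_fin (le_trans (cLnorm_ge0 f) fr). Qed.

Let measurable_pow f : cmeasurable f ->
  measurable_fun setT (fun t : borel G => (nc (f t) `^ p)%:E).
Proof.
move=> mf; apply/measurable_EFinP.
apply: (@measurableT_comp _ _ _ _ _ _ (@powR R ^~ p)) => //.
exact: cmeasurable_nc.
Qed.

Let pow_ge0 f (t : borel G) : setT t -> (0 <= (nc (f t) `^ p)%:E)%E.
Proof. by rewrite lee_fin powR_ge0. Qed.

Let pow_int_ge0 f : (0 <= \int[m]_t (nc (f t) `^ p)%:E)%E.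
Proof. by apply: integral_ge0 => t; exact: pow_ge0. Qed.

Lemma cLnorm_le f (r : R) : 0 <= r ->
  (cLnorm m p f <= r%:E)%E <-> (\int[m]_t (nc (f t) `^ p)%:E <= (r `^ p)%:E)%E.
Proof.
move=> r0; rewrite cLnormE; split => h.
- have := @gt0_ler_poweR R p (ltW p_gt0) _ _ _ _ h.
  rewrite -poweRrM mulVf// poweRe1// poweR_EFin; apply.
  + by rewrite in_itv /= poweR_ge0 leey.
  + by rewrite in_itv /= lee_fin r0 leey.
- have p'0 : 0 <= p^-1 by rewrite invr_ge0 ltW.
  have := @gt0_ler_poweR R p^-1 p'0 _ _ _ _ h.
  rewrite poweR_EFin -powRrM mulfV// powRr1//; apply.
  + by rewrite in_itv /= pow_int_ge0 leey.
  + by rewrite in_itv /= lee_fin powR_ge0 leey.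
Qed.

Lemma Lp_le_bounded f (B : R) : cmeasurable f -> (forall t, nc (f t) <= B) ->
  Lp_le f B.
Proof.
move=> mf fB; split => //; have B0 : 0 <= B := le_trans (nc_ge0 _) (fB 0).
apply/cLnorm_le => //.
have <- : (\int[m]_t (cst (B `^ p)%:E t) = (B `^ p)%:E)%E.
  rewrite integral_cst// -[RHS]mule1; congr (_ * _)%E.
  exact: probability_setT.
apply: ge0_le_integral => //.
- exact: pow_ge0.
- exact: measurable_pow.
- by move=> t _; rewrite lee_fin ge0_ler_powR// ?ltW// nnegrE nc_ge0.
Qed.

Lemma Lp_leW f r s : Lp_le f r -> r <= s -> Lp_le f s.
Proof. by move=> [mf fr] rs; split => //; rewrite (le_trans fr)// lee_fin. Qed.

Lemma Lp_leZ (c : R[i]) f r : Lp_le f r -> Lp_le (fun t => c * f t) (nc c * r).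
Proof.
move=> fr; have r0 := Lp_le_ge0 fr; have [mf] := fr.
move=> /(cLnorm_le _ r0) h; split; first exact: cmeasurableZ.
apply/cLnorm_le; first by rewrite mulr_ge0 ?nc_ge0.
under eq_integral do rewrite Normc.normcM powRM ?nc_ge0// EFinM.
rewrite ge0_integralZl_EFin ?powR_ge0//.
- rewrite powRM ?nc_ge0// EFinM lee_wpmul2l// lee_fin powR_ge0//.
- exact: pow_ge0.
- exact: measurable_pow.
Qed.

Lemma Lp_le_star f r : Lp_le f r -> Lp_le (star f) r.
Proof.
move=> [mf fr]; have mp := measure_preserving_opp G_hausdorff G_compact m_haar.
split; first by apply: cmeasurable_conj; exact: (cmeasurable_mp mp mf).
have -> : cLnorm m p (star f) = cLnorm m p f; last exact: fr.
rewrite !cLnormE; congr poweR.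
rewrite -[RHS](ge0_integral_mp mp (measurable_pow mf)).
  by apply: eq_integral => t _; rewrite /star nc_conj.
by move=> t; exact: pow_ge0.
Qed.

Lemma Lp_leD f g r s : Lp_le f r -> Lp_le g s ->
  Lp_le (fun t => f t + g t) (r + s).
Proof.
move=> [mf fr] [mg gs]; split; first exact: cmeasurableD.
have p1 : 1 <= p by rewrite ltW// (lt_trans _ p_gt2)// ltr1n.
have := minkowski_EFin m (cmeasurable_nc mf) (cmeasurable_nc mg) p1.
move=> /le_trans/(_ (leeD fr gs)); rewrite EFinD; apply: le_trans.
rewrite /cLnorm unlock; apply: gt0_ler_poweR.
- by rewrite invr_ge0 ltW.
- by rewrite in_itv /= leey andbT integral_ge0// => t _; exact: poweR_ge0.
- by rewrite in_itv /= leey andbT integral_ge0// => t _; exact: poweR_ge0.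
- apply: ge0_le_integral => //.
  + by move=> t _; exact: poweR_ge0.
  + under eq_fun do rewrite gee0_abs ?lee_fin ?nc_ge0//.
    exact: (measurable_pow (cmeasurableD mf mg)).
  + rewrite (_ : (fun _ => _) =
        (fun t : borel G => ((nc (f t) + nc (g t)) `^ p)%:E)); last first.
      by apply/funext => t; rewrite gee0_abs// lee_fin addr_ge0 ?nc_ge0.
    apply/measurable_EFinP.
    apply: (@measurableT_comp _ _ _ _ _ _ (@powR R ^~ p)) => //.
    by apply: measurable_funD; exact: cmeasurable_nc.
  + move=> t _; rewrite !gee0_abs ?lee_fin ?nc_ge0 ?addr_ge0 ?nc_ge0//.
    by rewrite ge0_ler_powR ?nnegrE ?addr_ge0 ?nc_ge0 ?le_ncD// ltW.
Qed.

(** Young's inequality for the product of u^2 and 1, with exponent p / 2 and its conjugate. The two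
    weights add up to 1, so integrating over a probability space gives the inclusion of L^p in L^2
    with constant 1. *)
Let young (u : R) : 0 <= u -> u ^+ 2 <= 2 / p * u `^ p + (1 - 2 / p).
Proof.
move=> u0; have q0 : 0 < p / 2 by rewrite divr_gt0.
have q'0 : 0 < (1 - 2 / p)^-1.
  by rewrite invr_gt0 subr_gt0 ltr_pdivrMr// mul1r.
have := @conjugate_powR R (u ^+ 2) 1 _ _ (sqr_ge0 u) ler01 q0 q'0.
rewrite invf_div invrK subrKC => /(_ erefl).
rewrite mulr1 powR1 mul1r -powR_mulrn// -powRrM.
by rewrite [2%:R * _]mulrC divfK ?pnatr_eq0// mulrC.
Qed.

Lemma Lp_le_L2 f r : Lp_le f r -> L2 m f /\ N2 m f <= r ^+ 2.
Proof.
move=> fr; have r0 := Lp_le_ge0 fr; have [mf _] := fr.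
(* Young's inequality is applied to |f| / s, which needs s > 0; the bound r = 0 is reached by
   letting s tend to 0. *)
have key s : 0 < s -> r <= s -> L2 m f /\ N2 m f <= s ^+ 2.
  move=> s0 rs; have [_ /(cLnorm_le _ (ltW s0)) h] := Lp_leW fr rs.
  have Ip : m.-integrable setT (fun t => (nc (f t) `^ p)%:E).
    apply/integrableP; split; first exact: measurable_pow.
    under eq_integral do rewrite gee0_abs ?lee_fin ?powR_ge0//.
    by rewrite (le_lt_trans h)// ltry.
  have Rp : Rintegral m setT (fun t : borel G => nc (f t) `^ p) <= s `^ p.
    rewrite -lee_fin /Rintegral fineK//.
    exact: integrable_fin_num.
  have bnd t : nc (f t) ^+ 2 <=
      (s ^+ 2 * (2 / p) / s `^ p) * nc (f t) `^ p + s ^+ 2 * (1 - 2 / p).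
    have := young (divr_ge0 (nc_ge0 (f t)) (ltW s0)).
    have s'0 : 0 <= s^-1 by rewrite invr_ge0 ltW.
    rewrite (powRM _ (nc_ge0 (f t)) s'0) expr_div_n ler_pdivrMr ?exprn_gt0//.
    rewrite -(powR_inv1 (ltW s0)) -powRrM mulN1r powRN.
    by move=> h2; rewrite (le_trans h2)// le_eqVlt; apply/orP; left; apply/eqP; ring.
  have IR : m.-integrable setT (EFin \o (fun t : borel G =>
      (s ^+ 2 * (2 / p) / s `^ p) * nc (f t) `^ p + s ^+ 2 * (1 - 2 / p))).
    by apply: integD; [exact: integZ Ip|exact: integ_cst].
  have Lf : L2 m f.
    split => //; apply: (integ_le _ _ IR).
      by apply: measurable_funX; exact: cmeasurable_nc.
    by move=> t; rewrite ger0_norm ?sqr_ge0.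
  split => //; have [_ I2] := Lf.
  rewrite (le_trans (Rintegral_le I2 IR bnd))//.
  rewrite RintegralD//; [|exact: integZ Ip|exact: integ_cst].
  rewrite RintegralZl// (Rintegral1 m).
  have sp : 0 < s `^ p by rewrite powR_gt0.
  have : s ^+ 2 * (2 / p) / s `^ p *
     Rintegral m setT (fun t : borel G => nc (f t) `^ p) <= s ^+ 2 * (2 / p).
    rewrite -mulrA ger_pMr.
      by rewrite ler_pdivrMl// mulr1.
    by rewrite mulr_gt0 ?exprn_gt0// divr_gt0.
  by rewrite mulrBr mulr1; lra.
move: r0; rewrite le_eqVlt => /predU1P[r0|r0]; last exact: key.
have r1 : r <= 1 by rewrite -r0 ler01.
have [Lf _] := key 1 ltr01 r1.
  split => //; rewrite -r0 expr0n; apply/ler_addgt0Pr => e e0; rewrite add0r.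
  have se : 0 < Num.sqrt e by rewrite sqrtr_gt0.
  have [|_] := key _ se; first by rewrite -r0 ltW.
  by rewrite sqr_sqrtr// ltW.
Qed.

Lemma Lp_le_conv f g r s : Lp_le f r -> Lp_le g s -> Lp_le (f ** g) (r * s).
Proof.
move=> fr gs; have [[Lf Nf] [Lg Ng]] := (Lp_le_L2 fr, Lp_le_L2 gs).
have [r0 s0] := (Lp_le_ge0 fr, Lp_le_ge0 gs).
apply: Lp_le_bounded; first by apply: ucont_cmeasurable; exact: ucont_conv.
move=> t; apply: nc_le_of_sqr; first exact: mulr_ge0.
rewrite (le_trans (nc_conv_le G_hausdorff G_compact m_haar t Lf Lg))//.
by rewrite exprMn ler_pM ?N2_ge0.
Qed.

Definition u_le (x : R[i] * (G -> R[i])) (r : R) :=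
  exists2 s, Lp_le x.2 s & nc x.1 + s <= r.

Lemma u_leP x r : u_le x r -> Lp1 m p x /\ (unorm m p x <= r%:E)%E.
Proof.
move=> [s [mx xs] h]; split.
  by split => //; rewrite (le_lt_trans xs)// ltry.
by rewrite /unorm (@le_trans _ _ (nc x.1 + s)%:E)// EFinD leeD2l.
Qed.

Lemma unorm_le x r : Lp1 m p x -> (unorm m p x <= r%:E)%E -> u_le x r.
Proof.
move=> [mx fin]; have fn : cLnorm m p x.2 \is a fin_num.
  by rewrite ge0_fin_numE// cLnorm_ge0.
rewrite /unorm -(fineK fn) -EFinD lee_fin => h.
by exists (fine (cLnorm m p x.2)) => //; split => //; rewrite fineK.
Qed.

Lemma u_le_L2 x r : u_le x r -> L2 m x.2.
Proof. by move=> [s /Lp_le_L2[]]. Qed.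

Lemma u_le_mul x y r s : u_le x r -> u_le y s -> u_le (umul m x y) (r * s).
Proof.
move=> [a xa ha] [b yb hb].
exists (nc x.1 * b + nc y.1 * a + a * b).
  apply: Lp_leD; last exact: Lp_le_conv.
  by apply: Lp_leD; exact: Lp_leZ.
have [a0 b0] := (Lp_le_ge0 xa, Lp_le_ge0 yb).
rewrite /= Normc.normcM.
have := ler_pM (addr_ge0 (nc_ge0 x.1) a0) (addr_ge0 (nc_ge0 y.1) b0) ha hb.
by move: (nc x.1) (nc y.1) => u v; lra.
Qed.

Lemma ufourier_mul x y r s chi : u_le x r -> u_le y s -> chargroup chi ->
  ufourier m (umul m x y) chi = ufourier m x chi * ufourier m y chi.
Proof.
move=> /u_le_L2 Lx /u_le_L2 Ly c; rewrite /ufourier /umul /=.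
have Lc := L2_conv G_hausdorff G_compact m_haar Lx Ly.
have [Zx Zy] := (L2Z y.1 Lx, L2Z x.1 Ly).
rewrite (hatD G_compact (L2D Zy Zx) Lc c) (hatD G_compact Zy Zx c).
rewrite !(hatZ G_compact)// (hat_conv G_hausdorff G_compact m_haar)//.
move: (fourier m x.2 chi) (fourier m y.2 chi) => u v; ring.
Qed.

Lemma ufourier_le x r chi : u_le x r -> chargroup chi ->
  nc (ufourier m x chi) <= r.
Proof.
move=> [s xs h] c; have [Lx Nx] := Lp_le_L2 xs; have s0 := Lp_le_ge0 xs.
rewrite (le_trans (le_ncD _ _))// (le_trans _ h)// lerD2l.
by apply: nc_le_of_sqr => //; exact: le_trans (hat_le G_compact Lx c) Nx.
Qed.

Definition ustar (x : R[i] * (G -> R[i])) := (x.1^*, star x.2).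

Lemma u_le_star x r : u_le x r -> u_le (ustar x) r.
Proof.
by move=> [s xs h]; exists s; [exact: Lp_le_star|rewrite /= nc_conj].
Qed.

Lemma ufourier_star x r chi : u_le x r -> chargroup chi ->
  ufourier m (ustar x) chi = (ufourier m x chi)^*.
Proof.
move=> /u_le_L2 Lx c; rewrite /ufourier /ustar /= conjcD.
by rewrite (hat_star G_hausdorff G_compact m_haar).
Qed.

End LpBounds.

(** * Fourier series *)

Section SeqSums.
Context {R : numDomainType} {I : eqType}.
Implicit Types (s : seq I) (F H : I -> R).

Lemma ler_sum_mem s F H : (forall i, i \in s -> F i <= H i) ->
  \sum_(i <- s) F i <= \sum_(i <- s) H i.
Proof. by move=> FH; rewrite !big_seq; exact: ler_sum. Qed.

Lemma sum_const_seq s (x : R) : \sum_(i <- s) x = (size s)%:R * x.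
Proof. by rewrite big_const_seq count_predT iter_addr_0 mulr_natl. Qed.

Lemma sum_filterC {V : zmodType} (s r : seq I) (F : I -> V) : uniq s -> uniq r ->
  {subset r <= s} -> \sum_(i <- s) F i - \sum_(i <- r) F i =
  \sum_(i <- [seq i <- s | i \notin r]) F i.
Proof.
move=> us ur rs; rewrite (bigID (mem r)) /=.
rewrite -(big_filter s (mem r)) -(big_filter s (fun i => i \notin r)).
have -> : \sum_(i <- [seq i <- s | mem r i]) F i = \sum_(i <- r) F i.
  apply: perm_big; apply: uniq_perm => //; first exact: filter_uniq.
  by move=> i; rewrite mem_filter; apply/andP/idP => [[]//|ir]; split => //; exact: rs.
by rewrite addrAC subrr add0r.
Qed.

End SeqSums.

(** * Large Fourier coefficients, Fourier synthesis, and the scalar part *)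

Section DualGroup.
Context {R : realType} {G : topologicalZmodType} (m : probability (borel G) R).
Implicit Types f g h chi psi : G -> R[i].

Local Notation "'E[ h ]" := (Rintegral m setT (h : borel G -> R))
  (at level 0, h at level 99).
Local Notation integ h := (m.-integrable setT (EFin \o (h : borel G -> R))).
Local Notation hat := (fourier m).

Hypothesis G_hausdorff : hausdorff_space G.
Hypothesis G_compact : compact [set: G].
Hypothesis m_haar : is_haar m.

Lemma finite_large_coeffs h (e : R) : L2 m h -> 0 < e ->
  exists s, uniq s /\
    forall chi, chi \in s <-> chargroup chi /\ e <= nc (hat h chi).
Proof.
move=> Lh e0; apply: contrapT => /forallNP no.
(* If no finite list were exhaustive, every list of large characters could be extended, giving lists
   of every length; Bessel bounds the length by N2 h / e^2. *)
have H n : exists s, [/\ uniq s, size s = n &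
    forall chi, chi \in s -> chargroup chi /\ e <= nc (hat h chi)].
  elim: n => [|n [s [us sn cs]]]; first by exists [::].
  have /not_andP[//|/existsNP[chi chis]] := no s.
  have [cchi chiNs] : (chargroup chi /\ e <= nc (hat h chi)) /\ chi \notin s.
    have [ins|nins] := boolP (chi \in s); last first.
      split => //; apply: contrapT => ncc; apply: chis; split => //.
      by rewrite (negbTE nins).
    by exfalso; apply: chis; split => // _; exact: cs.
  exists (chi :: s); split => /=; [by rewrite chiNs|by rewrite sn|].
  by move=> psi; rewrite inE => /predU1P[->//|]; exact: cs.
have [s [us sn cs]] := H (Num.bound (N2 m h / e ^+ 2)).
have := bessel G_compact m_haar Lh us (fun chi chis => (cs chi chis).1).
have : (size s)%:R * e ^+ 2 <= \sum_(chi <- s) nc (hat h chi) ^+ 2.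
  rewrite -sum_const_seq; apply: ler_sum_mem => chi chis.
  by rewrite lerXn2r ?nnegrE ?nc_ge0 ?(ltW e0)//; have [] := cs chi chis.
move=> /le_trans h1 /h1; rewrite sn leNgt -ltr_pdivrMr ?exprn_gt0//.
by rewrite archi_boundP// divr_ge0 ?N2_ge0 ?sqr_ge0.
Qed.

Definition trigpoly (s : seq (G -> R[i])) (c : (G -> R[i]) -> R[i]) t :=
  \sum_(chi <- s) c chi * chi t.

Lemma trigpoly_cons chi s c : trigpoly (chi :: s) c =
  fun t => c chi * chi t + trigpoly s c t.
Proof. by apply/funext => t; rewrite /trigpoly big_cons. Qed.

Lemma trigpoly_ucont s c : (forall chi, chi \in s -> chargroup chi) ->
  ucont (trigpoly s c).
Proof.
elim: s => [_|chi s IH cs].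
  rewrite (_ : trigpoly _ _ = fun=> 0); first exact: ucont_cst.
  by apply/funext => t; rewrite /trigpoly big_nil.
rewrite trigpoly_cons; apply: ucontD; last first.
  by apply: IH => psi ps; apply: cs; rewrite inE ps orbT.
by apply: ucontZ; apply: char_ucont; apply: cs; rewrite mem_head.
Qed.

Lemma hat_trigpoly s c psi : uniq s ->
  (forall chi, chi \in s -> chargroup chi) -> chargroup psi ->
  hat (trigpoly s c) psi = if psi \in s then c psi else 0.
Proof.
move=> + + cpsi; elim: s => [_ _|chi s IH /= /andP[chis us] cs].
  rewrite /fourier (_ : trigpoly _ _ = fun=> 0).
    under eq_fun do rewrite mul0r.
    by rewrite (cintegral_real m (cst 0)) Rintegral1.
  by apply/funext => t; rewrite /trigpoly big_nil.
have cchi : chargroup chi by apply: cs; rewrite mem_head.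
have cs' phi : phi \in s -> chargroup phi.
  by move=> ps; apply: cs; rewrite inE ps orbT.
have Lt := ucont_L2 m G_compact (trigpoly_ucont c cs').
have Lc := char_L2 m G_compact cchi.
rewrite trigpoly_cons (hatD G_compact (L2Z _ Lc) Lt cpsi) (hatZ G_compact)//.
rewrite (hat_char G_compact m_haar cchi cpsi) IH// inE.
have [->|ne] := eqVneq psi chi; first by rewrite (negbTE chis) mulr1 addr0.
by rewrite mulr0 add0r.
Qed.

Lemma nc_trigpoly_le s c t : (forall chi, chi \in s -> chargroup chi) ->
  nc (trigpoly s c t) <= \sum_(chi <- s) nc (c chi).
Proof.
move=> cs; apply: le_trans (le_nc_sum _ _) _; apply: ler_sum_mem => chi chis.
by have [_ _ chi1] := cs chi chis; rewrite Normc.normcM chi1 mulr1.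
Qed.

(* The coefficients decay like [nc (hat h chi) ^ 3], so by Bessel's inequality the
   Fourier series converges uniformly along the level sets of [hat h]. *)
Lemma fourier_synthesis h (c : (G -> R[i]) -> R[i]) (C : R) : L2 m h ->
  N2 m h <= 1 -> 0 <= C ->
  (forall chi, chargroup chi -> nc (c chi) <= C * nc (hat h chi) ^+ 3) ->
  exists g, [/\ ucont g, forall chi, chargroup chi -> hat g chi = c chi &
    forall t, nc (g t) <= C * N2 m h].
Proof.
move=> Lh Nh C0 cC.
have e0 j : 0 < (j.+1%:R)^-1 :> R by rewrite invr_gt0.
pose s j := projT1 (cid (finite_large_coeffs Lh (e0 j))).
have us j : uniq (s j) by rewrite /s; case: cid => ? [].
have sP j chi : chi \in s j <-> chargroup chi /\ (j.+1%:R)^-1 <= nc (hat h chi).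
  by rewrite /s; case: cid => ? [].
have cs j chi : chi \in s j -> chargroup chi by move/(sP j chi) => [].
pose g j := trigpoly (s j) c.
have ug j : ucont (g j) by apply: trigpoly_ucont; exact: cs.
have CN0 : 0 <= C * N2 m h by rewrite mulr_ge0 ?N2_ge0.
have coeff1 chi : chargroup chi -> nc (hat h chi) <= 1.
  move=> cchi; apply: nc_le_of_sqr => //.
  by rewrite expr1n (le_trans (hat_le G_compact Lh cchi)).
(* Where |hat h| <= e, one factor of its cube is at most e and Bessel sums the other two. This
   serves with e = 1 / (N + 1) for the Cauchy property and with e = 1 for the final bound. *)
have tail (r : seq (G -> R[i])) (e : R) : uniq r -> 0 <= e ->
    (forall chi, chi \in r -> chargroup chi /\ nc (hat h chi) <= e) ->
    \sum_(chi <- r) nc (c chi) <= e * (C * N2 m h).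
  move=> ur e_ge0 re.
  rewrite (@le_trans _ _ (\sum_(chi <- r) (e * C) * nc (hat h chi) ^+ 2))//.
    apply: ler_sum_mem => chi chir; have [cchi he] := re chi chir.
    rewrite (le_trans (cC chi cchi))// exprS mulrCA -mulrA.
    by rewrite ler_wpM2r// mulr_ge0// sqr_ge0.
  rewrite -mulr_sumr -mulrA ler_wpM2l// ler_wpM2l//.
  by apply: (bessel G_compact m_haar) => // chi /re[].
have incr i j : (i <= j)%N -> {subset s i <= s j}.
  move=> ij chi /(sP i chi)[cchi h1]; apply/sP; split => //.
  by rewrite (le_trans _ h1)// lef_pV2 ?posrE// ler_nat.
have step N j t : (N <= j)%N -> nc (g j t - g N t) <= N.+1%:R^-1 * (C * N2 m h).
  move=> Nj; have -> : g j t - g N t = trigpoly [seq chi <- s j | chi \notin s N] c t.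
    by rewrite /g /trigpoly; apply: sum_filterC => //; exact: incr.
  rewrite (le_trans (nc_trigpoly_le _ _ _))//.
    by move=> chi; rewrite mem_filter => /andP[_]; exact: cs.
  apply: tail; [exact: filter_uniq|exact: ltW|].
  move=> chi; rewrite mem_filter => /andP[nN chij].
  have cchi := cs j chi chij; split => //.
  rewrite leNgt; apply/negP => lt; move/negP : nN; apply; apply/sP.
  by split => //; exact: ltW.
have [gl gcvg] : exists gl, unif_cvg g gl.
  apply: unif_cauchy_cvg => e egt0.
  pose N := Num.bound (2 * (C * N2 m h) / e).
  have hN : 2 * (C * N2 m h) / e < N.+1%:R.
    rewrite (@lt_trans _ _ N%:R) ?ltr_nat// archi_boundP//.
    by rewrite divr_ge0 ?mulr_ge0 ?N2_ge0// ltW.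
  exists N => i j Ni Nj t.
  have -> : g i t - g j t = (g i t - g N t) - (g j t - g N t).
    by rewrite opprB addrA subrK.
  rewrite (le_trans (le_ncD _ _))// normcN.
  rewrite (le_trans (lerD (step N i t Ni) (step N j t Nj)))//.
  move: hN; rewrite ltr_pdivrMr// => hN.
  by rewrite -mulrDr ler_pdivrMl// -mulr2n -[leLHS]mulr_natl ltW.
have ugl := unif_cvg_ucont ug gcvg.
exists gl; split => // [chi cchi|t].
  (* Each coefficient is eventually constant in j: a character with hat h chi <> 0 ends up in [s j],
     and otherwise c chi = 0 by the decay hypothesis. *)
  have [J HJ] : exists J, forall j, (J <= j)%N -> hat (g j) chi = c chi.
    have [h0|h0] := eqVneq (hat h chi) 0.
      exists 0%N => j _; rewrite hat_trigpoly//; last exact: cs.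
      have c0 : c chi = 0.
        apply/eqP; rewrite -nc_eq0 eq_le nc_ge0 andbT.
        by rewrite (le_trans (cC chi cchi))// h0 Normc.normc0 expr0n mulr0.
      by rewrite c0 if_same.
    have h1 : 0 < nc (hat h chi) by rewrite nc_gt0.
    exists (Num.bound (nc (hat h chi))^-1) => j Jj.
    rewrite hat_trigpoly//; last exact: cs.
    case: ifPn => // /negP; case; apply/sP; split => //.
    rewrite invf_ple ?posrE//.
    rewrite (le_trans (ltW (archi_boundP _)))//; first by rewrite invr_ge0 ltW.
    by rewrite ler_nat (leq_trans Jj).
  have Lg j : L2 m (g j) by apply: ucont_L2; [|exact: ug].
  have Lgl := ucont_L2 m G_compact ugl.
  apply/eqP; rewrite -subr_eq0 -nc_eq0 eq_le nc_ge0 andbT.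
  apply/ler_addgt0Pr => e egt0; rewrite add0r.
  have [N HN] := gcvg e egt0; pose j := maxn N J.
  rewrite -(HJ j (leq_maxr _ _)) nc_distC -(hatB G_compact)//.
  apply: nc_le_of_sqr; first exact: ltW.
  have LB := L2B (Lg j) Lgl.
  rewrite (le_trans (hat_le G_compact LB cchi))//.
  by apply: N2_bounded; [case: LB|exact: HN (leq_maxl _ _)].
apply/ler_addgt0Pr => e egt0; have [N HN] := gcvg e egt0.
have := HN N (leqnn N) t; rewrite nc_distC => h1.
rewrite -(subrK (g N t) (gl t)) (le_trans (le_ncD _ _))// addrC lerD//.
rewrite (le_trans (nc_trigpoly_le _ _ (@cs N)))// -[leRHS]mul1r.
apply: tail => // chi chis; have cchi := cs N chi chis.
by split => //; exact: coeff1.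
Qed.

Lemma mreal_set1 (a : G) : mreal m [set a] = mreal m [set 0].
Proof.
have m0 : measurable ([set 0] : set (borel G)).
  by apply: closed_borel; apply: compact_closed => //; exact: compact_set1.
rewrite /mreal -((measure_preserving_shift m_haar (- a)).2 _ m0).
congr (fine (m _)); apply/seteqP; split => t /=; first by move=> ->; rewrite addNr.
by move/eqP; rewrite addrC subr_eq0 => /eqP.
Qed.

(** All points have the same mass q, and N distinct points have total mass N q <= 1 for every N. *)
Lemma haar_set1 : infinite_set [set: G] -> mreal m [set 0] = 0.
Proof.
move=> Ginf; set q := mreal m [set 0].
have q0 : 0 <= q by exact: fine_ge0.
have mset a : measurable ([set a] : set (borel G)).
  by apply: closed_borel; apply: compact_closed => //; exact: compact_set1.
have sum (s : seq G) : integ (fun t => \sum_(a <- s) \1_[set a] t) /\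
    'E[fun t => \sum_(a <- s) \1_[set a] t] = (size s)%:R * q.
  elim: s => [|a s [Is Es]].
    under eq_fun do rewrite big_nil.
    by split; [exact: integ_cst|rewrite Rintegral1 mul0r].
  under eq_fun do rewrite big_cons; split.
    by apply: integD => //; exact: integ_indic.
  rewrite RintegralD//; last exact: integ_indic.
  by rewrite Es Rintegral_mreal// mreal_set1 -nat1r mulrDl mul1r.
have bound (s : seq G) : uniq s -> (size s)%:R * q <= 1.
  move=> us; have [Is <-] := sum s; rewrite -[leRHS](@Rintegral1 _ _ m 1).
  apply: Rintegral_le => //; first exact: integ_cst.
  move=> t; have -> : \sum_(a <- s) (\1_[set a] t : R) = (count_mem t s)%:R.
    rewrite -sum1_count natr_sum [RHS]big_mkcond; apply: eq_bigr => a _.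
    by rewrite indicE in_set1 eq_sym /=; case: eqP.
  by rewrite count_uniq_mem//; case: (_ \in _).
apply/eqP; rewrite eq_le q0 andbT leNgt; apply/negP => qgt0.
have [B _ hB] := infinite_set_fset (Num.bound q^-1) Ginf.
have := bound (finmap.enum_fset B) (finmap.fset_uniq B).
rewrite -ler_pdivlMr// mul1r leNgt => /negP; apply.
rewrite (lt_le_trans (archi_boundP _)) ?invr_ge0 ?(ltW qgt0)//.
by rewrite ler_nat.
Qed.

(* Otherwise the Fourier coefficients stay away from [0], so the dual is finite by
   Bessel; then the indicator of a neighbourhood [U] of [0] is a sum of [N]
   characters with coefficients at most [m U], whence [1 <= N * m U]. *)
Lemma scalar_part_ge (lambda : R[i]) f (delta : R) : infinite_set [set: G] ->
  L2 m f -> (forall chi, chargroup chi -> delta <= nc (lambda + hat f chi)) ->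
  delta <= nc lambda.
Proof.
move=> Ginf Lf hd; rewrite leNgt; apply/negP => lt.
have e0 : 0 < delta - nc lambda by rewrite subr_gt0.
have [s [us sP]] := finite_large_coeffs Lf e0.
have inS chi : chargroup chi -> chi \in s.
  move=> cchi; apply/sP; split => //.
  by rewrite lerBlDl (le_trans (hd chi cchi))// le_ncD.
have cs chi : chi \in s -> chargroup chi by move/(sP chi) => [].
(* With N characters in all, U is taken of measure below 1 / (N + 1), so that N * m U < 1. *)
have n0 : 0 < ((size s).+1%:R : R)^-1 by rewrite invr_gt0.
have m0 : measurable ([set 0] : set (borel G)).
  by apply: closed_borel; apply: compact_closed => //; exact: compact_set1.
have [U [oU U0] ] := outer_regular m_haar m0 n0.
rewrite haar_set1// add0r => mU.
have meU := open_borel oU.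
have nU : nbhs (0 : G) U by apply: open_nbhs_nbhs; split => //; exact: U0.
have Upos := haar_open_gt0 G_compact m_haar 0 oU nU.
have {}Upos : 0 < mreal m U by move: Upos; under eq_set do rewrite subr0.
pose u t : R[i] := (\1_U t : R)%:C.
have nu t : nc (u t) = \1_U t by rewrite nc_real ger0_norm// indicE ler0n.
have Lu : L2 m u.
  apply: (@L2_bounded _ _ _ _ 1); last by move=> t; rewrite nu indicE; case: (_ \in _).
  by split => /=; [exact: measurable_indic|exact: measurable_cst].
have hu chi : chargroup chi -> nc (hat u chi) <= mreal m U.
  move=> cchi; rewrite -Rintegral_mreal//; apply: nc_cintegral_le.
  - exact: cintegrable_hat.
  - exact: integ_indic.
  - by move=> t; rewrite Normc.normcM nu nc_conj; have [_ _ ->] := cchi; rewrite mulr1.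
pose P := trigpoly s (hat u).
have uP : ucont P by exact: trigpoly_ucont.
have LP := ucont_L2 m G_compact uP.
(* As [s] contains every character, [u] and [P] have the same Fourier coefficients. *)
have N0 : N2 m (fun t => u t - P t) = 0.
  apply: (fourier_inj G_hausdorff G_compact m_haar); first exact: L2B.
  move=> chi cchi; rewrite (hatB G_compact)// hat_trigpoly// inS// subrr//.
have PU t : nc (P t) <= (size s)%:R * mreal m U.
  rewrite (le_trans (nc_trigpoly_le _ _ cs))// -sum_const_seq.
  by apply: ler_sum_mem => chi /cs c; exact: hu.
have small : (size s)%:R * mreal m U < 1.
  move: mU; rewrite -div1r ltr_pdivlMr// mulrC => mU; rewrite (le_lt_trans _ mU)//.
  by rewrite ler_wpM2r ?ltW// ltr_nat.
have c0 : 0 < 1 - (size s)%:R * mreal m U by rewrite subr_gt0.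
move: c0; set c := 1 - _ => c0.
(* On U one has u = 1 and |P| <= N * m U, hence |u - P| >= c > 0, although u - P is null in L^2 and
   m U > 0. *)
have : c ^+ 2 * mreal m U <= 0.
  rewrite -N0 /N2 -Rintegral_mreal// -RintegralZl//; last exact: integ_indic.
  have [_ IB] := L2B Lu LP.
  apply: Rintegral_le => //; first by apply: integZ; exact: integ_indic.
  move=> t; have := nu t; rewrite !indicE.
  have [Ut|Ut] := boolP (t \in U) => nut; last by rewrite mulr0 sqr_ge0.
  rewrite mulr1 lerXn2r ?nnegrE ?nc_ge0 ?(ltW c0)//.
  have {}nut : nc (u t) = 1 := nut; rewrite (le_trans _ (le_ncB (u t) (P t)))//.
  by rewrite nut lerD2l lerN2 PU.
by rewrite leNgt mulr_gt0// exprn_gt0.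
Qed.

End DualGroup.

(** * The inverse *)

Section RealEstimates.
Context {R : realFieldType}.

(** The origin of c_n, with d = delta^2. If b < 0, then -b <= mu - d <= mu (1 - d) because mu <= 1,
    and oddness turns this into b^n >= - mu^n (1 - d)^n. *)
Lemma odd_power_sum_ge (n : nat) (d mu b : R) : odd n -> 0 < d -> d <= mu ->
  mu <= 1 -> d <= mu + b -> mu ^+ n * (1 - (1 - d) ^+ n) <= mu ^+ n + b ^+ n.
Proof.
move=> n_odd d0 dmu mu1 db; have mu0 : 0 < mu := lt_le_trans d0 dmu.
rewrite mulrBr mulr1 lerD2l; have [b0|b0] := leP 0 b.
  rewrite (@le_trans _ _ 0)// ?exprn_ge0// oppr_le0 mulr_ge0 ?exprn_ge0 ?(ltW mu0)//.
  by rewrite subr_ge0 (le_trans dmu).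
have -> : b ^+ n = - (- b) ^+ n.
  by rewrite -[in LHS](opprK b) exprNn -signr_odd n_odd mulN1r.
rewrite lerN2 -exprMn lerXn2r ?nnegrE ?oppr_ge0 ?(ltW b0)//.
  by rewrite mulr_ge0 ?(ltW mu0)// subr_ge0 (le_trans dmu).
rewrite mulrBr mulr1; have : mu * d <= d by rewrite ler_piMl// ltW.
lra.
Qed.

End RealEstimates.

Lemma cn_gt0 {R : realType} (n : nat) (delta : R) : (0 < n)%N -> 0 < delta ->
  delta ^+ 2 <= 1 -> 0 < cn n delta.
Proof.
move=> n0 d0 d1; rewrite /cn subr_gt0 exprn_ilt1 -?lt0n//; first by rewrite subr_ge0.
by rewrite gtrBl exprn_gt0.
Qed.

Section Inverse.
Context {R : realType} {G : topologicalZmodType} (m : probability (borel G) R).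
Variable p : R.
Hypothesis p_gt2 : 2 < p.

Hypothesis G_hausdorff : hausdorff_space G.
Hypothesis G_compact : compact [set: G].
Hypothesis m_haar : is_haar m.

Local Notation hat := (fourier m).

Lemma N2_eq0_ae (f : G -> R[i]) : L2 m f -> N2 m f = 0 ->
  {ae m, forall t : borel G, f t = 0}.
Proof.
move=> [mf If] N0.
have mf2 : measurable_fun setT (fun t : borel G => (nc (f t) ^+ 2)%:E).
  by apply/measurable_EFinP; apply: measurable_funX; exact: cmeasurable_nc.
have : (\int[m]_t `|(nc (f t) ^+ 2)%:E| = 0)%E.
  under eq_integral do rewrite gee0_abs ?lee_fin ?sqr_ge0//.
  by rewrite -(fineK (integrable_fin_num measurableT If)) -[fine _]/(N2 m f) N0.
move=> /(ae_eq_integral_abs m measurableT mf2).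
apply: filterS => t /(_ I)[] /eqP.
by rewrite sqrf_eq0 nc_eq0 => /eqP.
Qed.

(** The transform of the product is its scalar part plus the coefficients of its function part. With
    scalar part 1 those coefficients all vanish, and injectivity of the Fourier transform
    concludes. *)
Lemma ueq_uone u v r s : u_le m p u r -> u_le m p v s -> u.1 * v.1 = 1 ->
  (forall chi, chargroup chi -> ufourier m u chi * ufourier m v chi = 1) ->
  ueq m (umul m u v) (uone R G).
Proof.
move=> ur vs uv1 uvhat; split => //=.
have uv := u_le_mul p_gt2 G_hausdorff G_compact m_haar ur vs.
have L := u_le_L2 p_gt2 uv; apply: N2_eq0_ae => //.
apply: (fourier_inj G_hausdorff G_compact m_haar) => // chi cchi.
have := ufourier_mul p_gt2 G_hausdorff G_compact m_haar ur vs cchi.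
by rewrite uvhat// {1}/ufourier [(umul _ _ _).1]/= uv1 -[RHS]addr0 => /addrI.
Qed.

Section Resolvent.
Variables (mu : R) (h : G -> R[i]).
Hypothesis mu_ge0 : 0 <= mu.
Hypothesis h_le : Lp_le m p h (1 - mu).

(* [geom_sum k] is the element [sum_(j < k) mu^(k-1-j) (-h)^j] of the unitization. *)
Fixpoint geom_sum (k : nat) : R[i] * (G -> R[i]) :=
  if k is k'.+1 then
    ((mu ^+ k')%:C, (umul m (0, fun t => -1 * h t) (geom_sum k')).2)
  else (0, fun=> 0).

Let mu_le1 : mu <= 1.
Proof. by have := Lp_le_ge0 h_le; rewrite subr_ge0. Qed.

Let mh_le : u_le m p (0, fun t => -1 * h t) (1 - mu).
Proof.
exists (1 - mu); last by rewrite (_ : nc _ = 0) ?add0r//; exact: Normc.normc0.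
by have := Lp_leZ p_gt2 (-1) h_le; rewrite normcN Normc.normc1 mul1r.
Qed.

(** Horner's recursion bounds the norm by mu^k + (1 - mu), which is at most 1 only when k >= 1; the
    induction therefore starts from the one-term sum, the unit. *)
Lemma geom_sum_le k : u_le m p (geom_sum k) 1.
Proof.
have zero_le : u_le m p (geom_sum 0) 0.
  exists 0; last by rewrite (_ : nc _ = 0) ?addr0//; exact: Normc.normc0.
  by apply: Lp_le_bounded => // t; rewrite Normc.normc0.
have step j r : u_le m p (geom_sum j) r ->
    u_le m p (geom_sum j.+1) (mu ^+ j + (1 - mu) * r).
  move=> jr; have [s xs] := u_le_mul p_gt2 G_hausdorff G_compact m_haar mh_le jr.
  rewrite /= mul0r Normc.normc0 add0r => sr; exists s => //.
  by rewrite -[(geom_sum j.+1).1]/((mu ^+ j)%:C) nc_real ger0_norm ?exprn_ge0// lerD2l.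
case: k => [|k].
  by have [s xs hs] := zero_le; exists s => //; rewrite (le_trans hs).
elim: k => [|k IH].
  have [s xs hs] := step _ _ zero_le; exists s => //.
  by rewrite (le_trans hs)// mulr0 addr0.
have [s xs hs] := step _ _ IH; exists s => //; rewrite (le_trans hs)//.
have : mu ^+ k.+1 <= mu by rewrite exprS ler_piMr// exprn_ile1.
lra.
Qed.

Lemma ufourier_geom_sum k chi : chargroup chi ->
  ufourier m (geom_sum k) chi * (mu%:C + hat h chi) =
  (mu ^+ k)%:C - (- hat h chi) ^+ k.
Proof.
move=> cchi; have [Lh _] := Lp_le_L2 p_gt2 h_le.
elim: k => [|k IH].
  rewrite /ufourier /fourier /=; under eq_fun do rewrite mul0r.
  by rewrite (cintegral_real m (cst 0)) Rintegral1 addr0 mul0r subrr.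
have := ufourier_mul p_gt2 G_hausdorff G_compact m_haar mh_le (geom_sum_le k) cchi.
rewrite {1 2}/ufourier [(0, _).1]/= [(umul _ _ _).1]/= mul0r !add0r.
rewrite [(0, _).2]/= (hatZ G_compact)// mulN1r => E.
rewrite {1}/ufourier [(geom_sum k.+1).1]/= [(geom_sum k.+1).2]/= E.
rewrite mulrDl -mulrA IH.
have -> : (mu ^+ k.+1)%:C = mu%:C * (mu ^+ k)%:C by rewrite exprS rmorphM.
rewrite exprS.
move: (hat h chi) (mu ^+ k)%:C mu%:C => b c d.
by move: ((- b) ^+ k) => e; ring.
Qed.

End Resolvent.

End Inverse.

Theorem theorem10 (R : realType) (G : topologicalZmodType)
    (G_hausdorff : hausdorff_space G) (G_compact : compact [set: G])
    (G_infinite : infinite_set [set: G])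
    (m : probability (borel G) R) (m_haar : is_haar m)
    (p : R) (p_gt2 : 2 < p)
    (delta : R) (delta_gt0 : 0 < delta)
    (lambda : R[i]) (f : G -> R[i]) (f_Lp : Lp m p f)
    (x_norm : (unorm m p (lambda, f) <= 1)%E)
    (x_inf : delta <=
      inf [set Normc.normc (ufourier m (lambda, f) chi) | chi in @chargroup R G])
    (n : nat) (n_odd : odd n) (n_ge : p - 1 <= n%:R)
    (n_min : forall k : nat, odd k -> p - 1 <= k%:R -> (n <= k)%N) :
  exists y : R[i] * (G -> R[i]),
    is_uinverse m p (lambda, f) y /\
    (unorm m p y <=
      (delta ^- (2 * n) + delta ^- (4 * n) / cn n delta)%:E)%E.
Proof.
(* From p > 2 one gets n > 1, and n is odd; three factors of hat h are what the Fourier synthesis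
   asks for. *)
have n_ge3 : (3 <= n)%N.
  have : 1 < n%:R :> R by move: n_ge; lra.
  by rewrite ltr1n; move: n_odd; clear; case: n => [|[|[|k]]].
pose x : R[i] * (G -> R[i]) := (lambda, f); pose X := ufourier m x.
have x_le : u_le m p x 1 by exact: unorm_le.
have Lf : L2 m f := u_le_L2 p_gt2 x_le.
have X_ge chi : chargroup chi -> delta <= nc (X chi).
  move=> cchi; rewrite (le_trans x_inf)//; apply: ge_inf; last by exists chi.
  by exists 0 => _ [psi _ <-]; exact: nc_ge0.
have X_le chi : chargroup chi -> nc (X chi) <= 1.
  exact: (ufourier_le p_gt2 G_compact).
have lambda_ge : delta <= nc lambda.
  exact: (scalar_part_ge G_hausdorff G_compact m_haar G_infinite Lf).
have [s f_le lambda_s] := x_le; rewrite /= in f_le lambda_s.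
have s0 := Lp_le_ge0 f_le.
have [mu muE] : {mu : R | mu = nc lambda ^+ 2} by exists (nc lambda ^+ 2).
have mu_ge : delta ^+ 2 <= mu by rewrite muE lerXn2r ?nnegrE ?nc_ge0 ?(ltW delta_gt0).
have lambda_le1 : nc lambda <= 1 by move: lambda_s; lra.
have mu_le1 : mu <= 1 by rewrite muE exprn_ile1 ?nc_ge0.
have d2_gt0 : 0 < delta ^+ 2 by rewrite exprn_gt0.
have mu_gt0 : 0 < mu by exact: lt_le_trans mu_ge.
pose xs := ustar x; have xs_le := u_le_star G_hausdorff G_compact m_haar x_le.
pose h := (umul m x xs).2.
(* The triangle inequality bounds h by 2 |lambda| s + s^2 = (|lambda| + s)^2 - mu, where |lambda| +
   s <= 1. *)
have h_le : Lp_le m p h (1 - mu).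
  have fs_le := Lp_le_star G_hausdorff G_compact m_haar f_le.
  apply: Lp_leW (_ : nc lambda * s + nc (lambda^*) * s + s * s <= _).
    apply: (Lp_leD p_gt2); last exact: (Lp_le_conv p_gt2).
    by apply: (Lp_leD p_gt2); exact: (Lp_leZ p_gt2).
  rewrite nc_conj muE; have := ler_pM _ _ lambda_s lambda_s.
  rewrite mulr1 => /(_ (addr_ge0 (nc_ge0 _) s0) (addr_ge0 (nc_ge0 _) s0)).
  by move: (nc lambda) => l; lra.
have [Lh Nh] := Lp_le_L2 p_gt2 h_le.
pose b chi : R := nc (X chi) ^+ 2 - mu.
have h_hat chi : chargroup chi -> fourier m h chi = (b chi)%:C.
  move=> cchi.
  have := ufourier_mul p_gt2 G_hausdorff G_compact m_haar x_le xs_le cchi.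
  rewrite (ufourier_star p_gt2 G_hausdorff G_compact m_haar x_le)// mul_conjc.
  have -> : (b chi)%:C = (nc (X chi) ^+ 2)%:C - mu%:C by exact: rmorphB.
  rewrite {1}/ufourier -/(X chi) => <-.
  by rewrite [(umul _ _ _).1]/= mul_conjc -muE addrC addKr.
have d2_le1 : delta ^+ 2 <= 1 by exact: le_trans mu_ge mu_le1.
have n0 : (0 < n)%N by exact: ltn_trans n_ge3.
have cn_gt0 : 0 < cn n delta by exact: cn_gt0.
pose D chi := mu ^+ n + b chi ^+ n.
have D_ge chi : chargroup chi -> mu ^+ n * cn n delta <= D chi.
  move=> cchi; apply: odd_power_sum_ge => //.
  by rewrite /b subrKC lerXn2r ?nnegrE ?nc_ge0 ?(ltW delta_gt0)// X_ge.
have mun_gt0 : 0 < mu ^+ n by rewrite exprn_gt0.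
have D_gt0 chi : chargroup chi -> 0 < D chi.
  by move=> /D_ge; apply: lt_le_trans; rewrite mulr_gt0.
have b_le1 chi : chargroup chi -> `|b chi| <= 1.
  move=> cchi; have X1 : nc (X chi) ^+ 2 <= 1 by rewrite exprn_ile1 ?nc_ge0 ?X_le.
  have X0 := sqr_ge0 (nc (X chi)).
  rewrite ler_norml /b; apply/andP; split; last first.
    by rewrite lerBlDl (le_trans X1)// lerDr ltW.
  by rewrite lerBrDl (le_trans _ X0)// subr_le0.
pose C := ((mu ^+ n) ^+ 2 * cn n delta)^-1.
have C_gt0 : 0 < C.
  by rewrite invr_gt0; apply: mulr_gt0 => //; apply: exprn_gt0.
(* The coefficients of z^-1 - mu^-n, that is 1 / D - 1 / mu^n. *)
pose c chi := (- (b chi ^+ n / (mu ^+ n * D chi)))%:C.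
have c_le chi : chargroup chi -> nc (c chi) <= C * nc (fourier m h chi) ^+ 3.
  move=> cchi; rewrite h_hat// !nc_real normrN normrM normrX normrV; last first.
    by rewrite unitfE mulf_neq0 ?gt_eqF// D_gt0.
  rewrite mulrC (gtr0_norm (mulr_gt0 mun_gt0 (D_gt0 chi cchi))).
  (* The denominator is at least mu^(2n) c_n; and |b| <= 1 with n >= 3 gives |b|^n <= |b|^3. *)
  apply: ler_pM => //; first by rewrite invr_ge0 ltW// mulr_gt0// D_gt0.
  - rewrite /C lef_pV2 ?posrE ?mulr_gt0 ?exprn_gt0 ?D_gt0//.
    by rewrite expr2 -mulrA ler_pM2l// D_ge.
  - by apply: ler_wiXn2l => //; exact: b_le1.
have Nh1 : N2 m h <= 1.
  rewrite (le_trans Nh)// exprn_ile1//; first exact: Lp_le_ge0 h_le.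
  by rewrite gerBl ltW.
have [g [ug g_hat g_le]] :=
  fourier_synthesis G_compact m_haar Lh Nh1 (ltW C_gt0) c_le.
pose z' : R[i] * (G -> R[i]) := ((mu ^- n)%:C, g).
have z'_le : u_le m p z' (mu ^- n + C).
  exists C; last by rewrite -[z'.1]/((mu ^- n)%:C) nc_real ger0_norm// invr_ge0 ltW.
  apply: (Lp_le_bounded m p_gt2); first exact: ucont_cmeasurable.
  by move=> t; rewrite (le_trans (g_le t))// -[leRHS]mulr1 ler_wpM2l// ltW.
have z'_hat chi : chargroup chi -> ufourier m z' chi = (D chi)^-1%:C.
  move=> cchi; rewrite /ufourier /= g_hat// -rmorphD; congr (_%:C).
  have D0 : D chi != 0 by rewrite gt_eqF// D_gt0.
  have mu0 : mu ^+ n != 0 by rewrite gt_eqF.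
  move: D0 mu0; rewrite /D; move: (mu ^+ n) (b chi ^+ n) => u v D0 u0.
  by field; rewrite u0 D0.
pose S := geom_sum m mu h n.
have S_le : u_le m p S 1.
  by apply: (geom_sum_le p_gt2 G_hausdorff G_compact m_haar) => //; exact: ltW.
pose y := umul m (umul m xs S) z'.
have xsS_le := u_le_mul p_gt2 G_hausdorff G_compact m_haar xs_le S_le.
have y_le := u_le_mul p_gt2 G_hausdorff G_compact m_haar xsS_le z'_le.
have xy_hat chi : chargroup chi -> X chi * ufourier m y chi = 1.
  move=> cchi.
  rewrite (ufourier_mul p_gt2 G_hausdorff G_compact m_haar xsS_le z'_le cchi).
  rewrite (ufourier_mul p_gt2 G_hausdorff G_compact m_haar xs_le S_le cchi).
  rewrite (ufourier_star p_gt2 G_hausdorff G_compact m_haar x_le)// z'_hat//.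
  rewrite !mulrA mul_conjc -/(X chi).
  have := ufourier_geom_sum p_gt2 G_hausdorff G_compact m_haar (ltW mu_gt0) h_le n cchi.
  rewrite h_hat// -rmorphD /b subrKC => SE; rewrite [_ * ufourier m S chi]mulrC SE.
  rewrite -rmorphN -rmorphXn -rmorphB -rmorphM.
  (* Oddness of n turns the telescoped difference mu^n - (-b)^n into the transform of z. *)
  have -> : mu ^+ n - (- (nc (X chi) ^+ 2 - mu)) ^+ n = D chi.
    by rewrite exprNn -signr_odd n_odd mulN1r opprK.
  by rewrite mulfV ?rmorph1// gt_eqF// D_gt0.
(* As n > 0, the scalar part of [S] is mu^(n-1), and |lambda|^2 mu^(n-1) mu^-n = 1. *)
have xy1 : lambda * y.1 = 1.
  rewrite /= /S; case: n n0 {n_odd n_ge n_min n_ge3 S S_le y xsS_le y_le xy_hat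
    cn_gt0 D D_ge D_gt0 C C_gt0 c c_le g ug g_hat g_le z' z'_le z'_hat}
    mun_gt0 => // k _ mun_gt0 /=.
  rewrite !mulrA mul_conjc -muE -!rmorphM -exprS.
  by rewrite mulfV ?gt_eqF.
exists y; split.
  have [y1 _] := u_leP y_le; split => //.
  - exact: (ueq_uone p_gt2 G_hausdorff G_compact m_haar x_le y_le).
  - apply: (ueq_uone p_gt2 G_hausdorff G_compact m_haar y_le x_le).
      by rewrite mulrC.
    by move=> chi cchi; rewrite mulrC; exact: xy_hat.
have [_ yn] := u_leP y_le; rewrite (le_trans yn)// lee_fin !mul1r.
have dn k : 0 < delta ^+ k by exact: exprn_gt0.
have dmu : delta ^+ (2 * n) <= mu ^+ n.
  by rewrite exprM lerXn2r ?nnegrE ?(ltW mu_gt0) ?sqr_ge0.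
(* Both terms are decreasing in mu^n, and mu^n >= delta^(2n). *)
apply: lerD; first by rewrite lef_pV2 ?posrE.
rewrite /C invfM ler_wpM2r ?invr_ge0 ?(ltW cn_gt0)//.
rewrite -[4%N]/(2 * 2)%N mulnAC exprM.
rewrite lef_pV2 ?posrE; [|exact: exprn_gt0..].
by apply: lerXn2r; rewrite ?nnegrE ?(ltW mun_gt0) ?(ltW (dn _)).
Qed.
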